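(* Let $\aleph$ be an infinite cardinal, $\mathbb K$ a field, and $I$ an $\aleph$-poset having a finite cofinal subset. Let $\mathrm{Prim}_{\mathfrak B(I)}$ be the set of primitive ideals of $\mathfrak B(I)$ ordered by inclusion, and let $\Psi:I\to\mathrm{Prim}_{\mathfrak B(I)}$ be the map defined by $\Psi(i)=H(I,\{i\not\le\})$. Then the following conditions are equivalent: (1) $\Psi$ is an order isomorphism; (2) $I$ is artinian (it satisfies the descending chain condition); (3) $\mathfrak B(I)$ is semiartinian.
   Context: An ideal of a ring is right (left) primitive if it is the annihilator of a simple right (left) module; for $\mathfrak B(I)$ right primitive and left primitive ideals coincide, and one simply says primitive. Each $H(I,\{i\not\le\})$ is a primitive ideal of $\mathfrak B(I)$. A ring $R$ is semiartinian if its Loewy chain ($\mathrm{Soc}_0(R)=0$, $\mathrm{Soc}_{\alpha+1}(R)/\mathrm{Soc}_\alpha(R)=\mathrm{Soc}(R/\mathrm{Soc}_\alpha(R))$, unions at limit ordinals, $\mathrm{Soc}$ being the right socle, which equals the left socle for regular rings such as $\mathfrak B(I)$) reaches $R$. Conventions. $\aleph$ is an infinite cardinal, regarded as an initial ordinal, so that $\emptyset\in\aleph$; $\mathbb K$ is a field. For a poset $P$, $\mathcal M(P)$ is the set of all maximal chains of $P$ (maximal totally ordered subsets). An $\aleph$-poset is a partially ordered set $I$ with $|I|\le\aleph$ and $|\mathcal M(I)|\le\aleph$. For $i\in I$: $\{i\le\}=\{k\in I: i\le k\}$, $\{\le i\}=\{k\in I:k\le i\}$, $\{i\not\le\}=I\setminus\{i\le\}$,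 with the induced orders. For a set $A$, $\aleph^{(A)}$ is the set of maps $p:A\to\aleph$ with $p(a)=\emptyset$ for all but finitely many $a\in A$. For a set $X$, $\mathrm{CFM}_X(\mathbb K)$ is the $\mathbb K$-algebra of column-finite $X\times X$ matrices over $\mathbb K$, and $\mathrm{FR}_X(\mathbb K)$ is its ideal of matrices with only finitely many nonzero rows; $a(x,y)$ denotes the entry of $a$ in row $x$, column $y$. Construction. Let $X(I)=\aleph^{(I)}\times\mathcal M(I)$ and $Q(I)=\mathrm{CFM}_{X(I)}(\mathbb K)$. For $i\in I$ let $X(i\le)=\aleph^{(\{i\le\})}\times\mathcal M(\{i\le\})$ and let $\psi_{I,i}:\mathrm{CFM}_{X(i\le)}(\mathbb K)\to Q(I)$ be the injective (not necessarily unital) $\mathbb K$-algebra homomorphism given, for $p,q\in\aleph^{(I)}$ and $A,B\in\mathcal M(I)$, by $$\psi_{I,i}(a)((p,A),(q,B))=a\big((p|_{\{i\le\}},A\cap\{i\le\}),(q|_{\{i\le\}},B\cap\{i\le\})\big)$$ if $i\in A\cap B$, $A\cap\{\le i\}=B\cap\{\le i\}$ and $p|_{\{i\not\le\}}=q|_{\{i\not\le\}}$, and $\psi_{I,i}(a)((p,A),(q,B))=0$ otherwise. Put $H(I,i)=\psi_{I,i}(\mathrm{FR}_{X(i\le)}(\mathbb K))$ if $i$ is not a maximal element of $I$, and $H(I,i)=\mathbb K\,\psi_{I,i}(\mathbf 1)$ if $i$ is a maximal element of $I$. For $J\subseteq I$ put $H(I,J)=\sum_{j\in J}H(I,j)\subseteq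 Q(I)$; this sum is direct and $H(I,J)$ is a (not necessarily unital) $\mathbb K$-subalgebra of $Q(I)$. Finally $\mathfrak B(I)=H(I,I)$, which is a unital subalgebra of $Q(I)$ when $I$ has a finite cofinal subset. *)

(* Defs.v *)
From HB Require Import structures.
From mathcomp Require Import all_boot all_order all_algebra.
From mathcomp Require Import generic_quotient ring_quotient.
From mathcomp Require Import finmap.
From mathcomp Require Import boolp classical_sets functions cardinality fsbigop.

Set Implicit Arguments.
Unset Strict Implicit.
Unset Printing Implicit Defensive.

Import Order.TTheory GRing.Theory.

Local Open Scope classical_set_scope.
Local Open Scope card_scope.
Local Open Scope ring_scope.

Section QuotientModule.
Variables (R : pzRingType) (M : lmodType R) (N : submodClosed M).

Definition submod_pred : {pred M} := N.

Fact submod_pred_zmod_closed : zmod_closed submod_pred.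
Proof.
split=> [|x y Nx Ny]; first exact: (rpred0 N).
by rewrite -scaleN1r; apply: (rpredD (S := N)) => //; apply: rpredZ.
Qed.

HB.instance Definition _ :=
  GRing.isZmodClosed.Build M submod_pred submod_pred_zmod_closed.

Definition quotmod : Type :=
  @Quotient.quot M submod_pred.

HB.instance Definition _ : EqQuotient M (Quotient.equiv submod_pred) quotmod :=
  EqQuotient.on quotmod.
HB.instance Definition _ := GRing.Zmodule.on quotmod.
HB.instance Definition _ := ZmodQuotient.on quotmod.

Definition quotmod_scale (a : R) (u : quotmod) : quotmod :=
  \pi_quotmod%qT (a *: repr u).

Lemma pi_scale (a : R) (x : M) :
  quotmod_scale a (\pi_quotmod%qT x) = \pi_quotmod%qT (a *: x).
Proof.
have Nd : repr (\pi_quotmod%qT x) - x \in submod_pred.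
  by rewrite Quotient.idealrBE reprK.
by apply/eqP; rewrite -Quotient.idealrBE -scalerBr; apply: (@rpredZ _ _ N).
Qed.

Fact quotmod_scaleA a b u :
  quotmod_scale a (quotmod_scale b u) = quotmod_scale (a * b) u.
Proof. by elim/quotW: u => x; rewrite (pi_scale b) !pi_scale scalerA. Qed.

Fact quotmod_scale1 : left_id 1 quotmod_scale.
Proof. by elim/quotW=> x; rewrite pi_scale scale1r. Qed.

Lemma pi_add (x y : M) :
  \pi_quotmod%qT (x + y) = \pi_quotmod%qT x + \pi_quotmod%qT y.
Proof. exact: (@Quotient.pi_add M submod_pred x y). Qed.

Fact quotmod_scaleDr : right_distributive quotmod_scale +%R.
Proof.
move=> a; elim/quotW=> x; elim/quotW=> y; rewrite -pi_add (pi_scale a x).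
by rewrite (pi_scale a y) (pi_scale a (x + y)) -pi_add scalerDr.
Qed.

Fact quotmod_scaleDl u : {morph quotmod_scale^~ u : a b / a + b}.
Proof.
by move=> a b; elim/quotW: u => x; rewrite !pi_scale -pi_add scalerDl.
Qed.

HB.instance Definition _ := GRing.Zmodule_isLmodule.Build R quotmod
  quotmod_scaleA quotmod_scale1 quotmod_scaleDr quotmod_scaleDl.
End QuotientModule.

Section Socle.
Variables (R : pzRingType) (M : lmodType R).

Definition simple_module : Prop :=
  (exists x : M, x != 0) /\
  forall N : submodClosed M, (forall x, x \in N -> x = 0) \/ (forall x, x \in N).

Definition simple_submodule (S : submodClosed M) : Prop :=
  (exists2 x : M, x \in S & x != 0) /\
  forall N : submodClosed M, {subset N <= S} ->
    (forall x, x \in N -> x = 0) \/ {subset S <= N}.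

Definition annihilator : set R := [set a | forall x : M, a *: x = 0].

Definition socle : set M :=
  [set x | exists s : seq M,
     (forall y, y \in s -> exists2 S, simple_submodule S & y \in S) /\
     x = \sum_(y <- s) y].
End Socle.

(* The Loewy chain of [M] is indexed by an ordinal, here a well-ordered type [W]
   whose least element is [\bot]; the three clauses treat zero, successors and
   limits. Transfinite recursion determines [L] when [W] is well-ordered. *)
Definition loewy_chain (R : pzRingType) (M : lmodType R)
    (d : Order.disp_t) (W : bOrderType d) (L : W -> submodClosed M) : Prop :=
  [/\ forall x, x \in L \bot%O <-> x = 0,
      forall a b : W, (a < b)%O -> (forall c, (c < b)%O -> (c <= a)%O) ->
        forall x, x \in L b <-> socle (\pi_(quotmod (L a))%qT x) &
      forall b : W, b != \bot%O ->
        (forall a, (a < b)%O -> exists2 c, (a < c)%O & (c < b)%O) ->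
        forall x, x \in L b <-> exists2 a, (a < b)%O & x \in L a].

Definition semiartinian_module (R : pzRingType) (M : lmodType R) : Prop :=
  exists (d : Order.disp_t) (W : bOrderType d) (L : W -> submodClosed M),
    [/\ well_founded (fun a b : W => (a < b)%O), loewy_chain L &
        exists a, forall x, x \in L a].

(* Right [R]-modules are the left modules over the converse ring [R^c], and
   [(R^c)^o] is [R] as a right module over itself. *)

Definition semiartinian (R : pzRingType) : Prop :=
  @semiartinian_module R^c (R^c)^o.

(* For the rings [frakB] below, left and right primitive ideals coincide, and
   "primitive" stands for "right primitive". *)
Definition right_primitive (R : pzRingType) (P : set R) : Prop :=
  exists2 M : lmodType R^c, simple_module M & P = annihilator M.

Section ColumnFinite.
Variables (X : choiceType) (K : fieldType).

Definition column_finite : set (X -> X -> K) :=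
  [set a | forall y, finite_set [set x | a x y != 0]].

Definition cfm : Type := set_type column_finite.

HB.instance Definition _ := Choice.on cfm.
HB.instance Definition _ := SubChoice.on cfm.

Definition cfm_fun (a : cfm) : X -> X -> K := val a.
Coercion cfm_fun : cfm >-> Funclass.

Lemma cfmP (a b : cfm) : (forall x y, a x y = b x y) -> a = b.
Proof. by move=> ab; apply/val_inj/funext => x; apply/funext => y; exact: ab. Qed.

Lemma cfm_finite (a : cfm) y : finite_set [set x | a x y != 0].
Proof. by have /set_mem := valP a; exact. Qed.

Definition Cfm (a : X -> X -> K) (ha : column_finite a) : cfm :=
  exist _ a (mem_set ha).

Lemma cfm_eq0 (a : cfm) y : exists A : {fset X}, forall x, x \notin A -> a x y = 0.
Proof.
exists (fset_set [set x | a x y != 0]) => x.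
rewrite in_fset_set; last exact: cfm_finite.
by move=> xN; apply/eqP; apply: contraNT xN => nz; rewrite inE.
Qed.

Lemma cfm_fset (a : X -> X -> K) :
    (forall y, exists A : {fset X}, forall x, x \notin A -> a x y = 0) ->
  column_finite a.
Proof.
move=> fa y; have [A Aa] := fa y.
apply: (sub_finite_set _ (finite_fset A)) => x /= nz.
by apply: contraNT nz => /Aa ->.
Qed.

Fact cfm0_subproof : column_finite (fun _ _ => 0).
Proof. by apply: cfm_fset => y; exists fset0. Qed.
Definition cfm0 := Cfm cfm0_subproof.

Fact cfm1_subproof : column_finite (fun x y => (x == y)%:R).
Proof.
apply: cfm_fset => y; exists [fset y]%fset => x.
by rewrite inE => /negPf ->.
Qed.
Definition cfm1 := Cfm cfm1_subproof.

Lemma cfm1E x y : cfm1 x y = (x == y)%:R.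
Proof. by []. Qed.

Fact cfm_opp_subproof (a : cfm) : column_finite (fun x y => - a x y).
Proof.
apply: cfm_fset => y; have [A Aa] := cfm_eq0 a y.
by exists A => x /Aa ->; rewrite oppr0.
Qed.
Definition cfm_opp a := Cfm (cfm_opp_subproof a).

Fact cfm_add_subproof (a b : cfm) : column_finite (fun x y => a x y + b x y).
Proof.
apply: cfm_fset => y; have [A Aa] := cfm_eq0 a y; have [B Bb] := cfm_eq0 b y.
exists (A `|` B)%fset => x; rewrite inE negb_or => /andP[/Aa -> /Bb ->].
by rewrite addr0.
Qed.
Definition cfm_add a b := Cfm (cfm_add_subproof a b).

Fact cfm_scale_subproof (k : K) (a : cfm) : column_finite (fun x y => k * a x y).
Proof.
apply: cfm_fset => y; have [A Aa] := cfm_eq0 a y.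
by exists A => x /Aa ->; rewrite mulr0.
Qed.
Definition cfm_scale k a := Cfm (cfm_scale_subproof k a).

Lemma cfm_mul_fset (a b : cfm) x y (A : {fset X}) :
    (forall z, z \notin A -> b z y = 0) ->
  \sum_(z \in setT) a x z * b z y = \sum_(z <- A) a x z * b z y.
Proof. by move=> Ab; apply: fsbigTE => z /Ab ->; rewrite mulr0. Qed.

(* [\sum_(z \in A)] is 0 for an infinite support; the one here is finite, as
   column [y] of [b] is. *)
Fact cfm_mul_subproof (a b : cfm) :
  column_finite (fun x y => \sum_(z \in [set: X]) a x z * b z y).
Proof.
apply: cfm_fset => y; have [A Ab] := cfm_eq0 b y.
have /choice[B Ba] := cfm_eq0 a.
exists (\bigcup_(z <- A) B z)%fset => x xB; rewrite (cfm_mul_fset _ _ Ab).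
rewrite big_seq big1 // => z zA; rewrite Ba ?mul0r //.
by apply: contra xB => xB; apply/bigfcupP; exists z => //; rewrite zA.
Qed.
Definition cfm_mul a b := Cfm (cfm_mul_subproof a b).

Lemma cfm_mulE_fset (a b : cfm) x y (A : {fset X}) :
    (forall z, z \notin A -> b z y = 0) ->
  cfm_mul a b x y = \sum_(z <- A) a x z * b z y.
Proof. exact: cfm_mul_fset. Qed.

Fact cfm_addA : associative cfm_add.
Proof. by move=> a b c; apply: cfmP => x y; exact: addrA. Qed.
Fact cfm_addC : commutative cfm_add.
Proof. by move=> a b; apply: cfmP => x y; exact: addrC. Qed.
Fact cfm_add0 : left_id cfm0 cfm_add.
Proof. by move=> a; apply: cfmP => x y; exact: add0r. Qed.
Fact cfm_addN : left_inverse cfm0 cfm_opp cfm_add.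
Proof. by move=> a; apply: cfmP => x y; exact: addNr. Qed.

HB.instance Definition _ :=
  GRing.isZmodule.Build cfm cfm_addA cfm_addC cfm_add0 cfm_addN.

Fact cfm_mulA : associative cfm_mul.
Proof.
move=> a b c; apply: cfmP => x w /=.
have [C Cc] := cfm_eq0 c w; have /choice[B Bb] := cfm_eq0 b.
pose E := (\bigcup_(z <- C) B z)%fset.
have Eb z y : z \in C -> y \notin E -> b y z = 0.
  move=> zC yE; apply: Bb; apply: contra yE => yB.
  by apply/bigfcupP; exists z => //; rewrite zC.
have Ebc y : y \notin E -> cfm_mul b c y w = 0.
  move=> yE; rewrite (cfm_mulE_fset _ _ Cc).
  by rewrite big_seq big1 // => z zC; rewrite (Eb z) ?mul0r.
rewrite (cfm_mulE_fset _ _ Ebc) (cfm_mulE_fset _ _ Cc).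
transitivity (\sum_(y <- E) \sum_(z <- C) a x y * (b y z * c z w)).
  apply: eq_bigr => y _; rewrite -mulr_sumr; congr (_ * _).
  exact: cfm_mulE_fset.
rewrite exchange_big /= [LHS]big_seq [RHS]big_seq; apply: eq_bigr => z zC.
rewrite (cfm_mulE_fset _ _ (Eb z ^~ zC)).
by rewrite mulr_suml; apply: eq_bigr => y _; rewrite mulrA.
Qed.

Fact cfm_mul1l : left_id cfm1 cfm_mul.
Proof.
move=> a; apply: cfmP => x y /=; have [A Aa] := cfm_eq0 a y.
have Ax z : z \notin (x |` A)%fset -> a z y = 0.
  by rewrite !inE negb_or => /andP[_ /Aa].
rewrite (cfm_mulE_fset _ _ Ax) (big_fsetD1 x) /= ?inE ?eqxx //.
rewrite cfm1E eqxx mul1r big_seq big1 ?addr0 // => z.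
by rewrite !inE cfm1E eq_sym => /andP[/negPf -> _]; rewrite mul0r.
Qed.

Fact cfm_mul1r : right_id cfm1 cfm_mul.
Proof.
move=> a; apply: cfmP => x y /=.
have Ay z : z \notin [fset y]%fset -> cfm1 z y = 0.
  by rewrite inE cfm1E => /negPf ->.
by rewrite (cfm_mulE_fset _ _ Ay) big_seq_fset1 cfm1E eqxx mulr1.
Qed.

Fact cfm_mulDl : left_distributive cfm_mul +%R.
Proof.
move=> a b c; apply: cfmP => x y /=; have [C Cc] := cfm_eq0 c y.
rewrite (cfm_mulE_fset _ _ Cc) [RHS](congr2 _ (cfm_mulE_fset a x Cc) (cfm_mulE_fset b x Cc)).
by rewrite -big_split; apply: eq_bigr => z _; exact: mulrDl.
Qed.

Fact cfm_mulDr : right_distributive cfm_mul +%R.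
Proof.
move=> a b c; apply: cfmP => x y /=.
have [B Bb] := cfm_eq0 b y; have [C Cc] := cfm_eq0 c y.
have Eb z : z \notin (B `|` C)%fset -> b z y = 0.
  by rewrite inE negb_or => /andP[/Bb].
have Ec z : z \notin (B `|` C)%fset -> c z y = 0.
  by rewrite inE negb_or => /andP[_ /Cc].
have Ebc z : z \notin (B `|` C)%fset -> cfm_add b c z y = 0.
  by move=> zE; rewrite /cfm_fun /= Eb // Ec // addr0.
rewrite (cfm_mulE_fset _ _ Ebc) [RHS](congr2 _ (cfm_mulE_fset a x Eb) (cfm_mulE_fset a x Ec)).
by rewrite -big_split; apply: eq_bigr => z _; exact: mulrDr.
Qed.

HB.instance Definition _ := GRing.Zmodule_isPzRing.Build cfm
  cfm_mulA cfm_mul1l cfm_mul1r cfm_mulDl cfm_mulDr.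

Fact cfm_scaleA k l (a : cfm) : cfm_scale k (cfm_scale l a) = cfm_scale (k * l) a.
Proof. by apply: cfmP => x y; exact: mulrA. Qed.
Fact cfm_scale1 : left_id 1 cfm_scale.
Proof. by move=> a; apply: cfmP => x y; exact: mul1r. Qed.
Fact cfm_scaleDr : right_distributive cfm_scale +%R.
Proof. by move=> k a b; apply: cfmP => x y; exact: mulrDr. Qed.
Fact cfm_scaleDl a : {morph cfm_scale^~ a : k l / k + l}.
Proof. by move=> k l; apply: cfmP => x y; exact: mulrDl. Qed.

HB.instance Definition _ := GRing.Zmodule_isLmodule.Build K cfm
  cfm_scaleA cfm_scale1 cfm_scaleDr cfm_scaleDl.

Definition finite_rows : set cfm :=
  [set a | finite_set [set x | exists y, a x y != 0]].
End ColumnFinite.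

(* An infinite cardinal is an infinite initial ordinal: a well-order not
   equipotent to any of its proper initial segments. Its least element [\bot] is
   the ordinal zero, that is, the empty set. *)
Definition infinite_cardinal (d : Order.disp_t) (N : bOrderType d) : Prop :=
  [/\ well_founded (fun a b : N => (a < b)%O),
      forall a : N, ~ ([set: N] #<= [set b : N | (b < a)%O]) &
      infinite_set [set: N]].

Section Posets.
Variables (d : Order.disp_t) (P : porderType d).

Definition maximal_chains : set (set P) :=
  [set A | total_on A <=%O /\
    forall B : set P, total_on B <=%O -> A `<=` B -> B = A].

Definition maximal_element (i : P) : Prop := forall j : P, (i <= j)%O -> j = i.

Definition finite_cofinal : Prop :=
  exists2 F : set P, finite_set F & forall x, exists2 y, F y & (x <= y)%O.

Definition artinian_poset : Prop :=
  forall f : nat -> P, (forall n, (f n.+1 <= f n)%O) ->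
    exists n, forall m, (n <= m)%N -> f m = f n.

Definition up (i : P) : Type := {x : P | (i <= x)%O}.

HB.instance Definition _ i := Choice.on (up i).
HB.instance Definition _ i := SubChoice.on (up i).
HB.instance Definition _ i :=
  Order.SubChoice_isSubPOrder.Build d P (fun x : P => (i <= x)%O) d (up i).

Lemma maximal_chainsP (A : set P) : maximal_chains A <->
  total_on A <=%O /\
  forall b, (forall a, A a -> (b <= a)%O \/ (a <= b)%O) -> A b.
Proof.
split=> -[Atot Amax]; split=> //.
  move=> b bA; rewrite -(Amax (A `|` [set b])); first by right.
    move=> x y [Ax|->] [Ay|->]; [exact: Atot| |exact: bA|by left].
    by case: (bA _ Ax); [right|left].
  by move=> x; left.
move=> B Btot AB; apply/seteqP; split=> // b Bb; apply: Amax => a Aa.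
exact/Btot/AB.
Qed.
End Posets.
Arguments maximal_chains {d} P.
Arguments finite_cofinal {d} P.
Arguments artinian_poset {d} P.

Definition aleph_poset (dN : Order.disp_t) (N : bOrderType dN)
    (d : Order.disp_t) (P : porderType d) : Prop :=
  [set: P] #<= [set: N] /\ maximal_chains P #<= [set: N].

Section Index.
Variables (dN : Order.disp_t) (N : bOrderType dN).
Variables (d : Order.disp_t) (P : porderType d).

Definition fin_supp : set (P -> N) :=
  [set p | finite_set [set a | p a != \bot%O]].

(* X(P), the set of row and column indices. *)
Definition index : Type := (fin_supp * maximal_chains P)%type.

HB.instance Definition _ := Choice.on index.

Definition idx_map (x : index) : P -> N := val x.1.
Definition idx_chain (x : index) : set P := val x.2.

Lemma index_eq (x y : index) :
  idx_map x =1 idx_map y -> idx_chain x = idx_chain y -> x = y.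
Proof.
case: x y => [x1 x2] [y1 y2] /funext e1 e2; congr pair; exact: val_inj.
Qed.

Lemma idx_chainP (x : index) : maximal_chains P (idx_chain x).
Proof. by have /set_mem := valP x.2. Qed.

Lemma idx_mapP (x : index) : fin_supp (idx_map x).
Proof. by have /set_mem := valP x.1. Qed.

Definition Index (p : P -> N) (A : set P) (hp : fin_supp p)
  (hA : maximal_chains P A) : index := (exist _ p (mem_set hp), exist _ A (mem_set hA)).

End Index.

Section Restriction.
Variables (dN : Order.disp_t) (N : bOrderType dN).
Variables (d : Order.disp_t) (P : porderType d) (i : P).
Notation X := (index N P).
Notation Xi := (index N (up i)).

Fact restr_map_subproof (x : X) :
  fin_supp (fun k : up i => idx_map x (val k)).
Proof.
apply: (finite_preimage (f := val) (B := [set a | idx_map x a != \bot%O])).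
  by move=> a b _ _; exact: val_inj.
exact: idx_mapP.
Qed.

Fact restr_chain_subproof (x : X) : idx_chain x i ->
  maximal_chains (up i) [set k | idx_chain x (val k)].
Proof.
move=> xi; have /maximal_chainsP[xtot xmax] := idx_chainP x.
apply/maximal_chainsP; split=> [a b xa xb|b bx]; first exact: xtot.
apply: xmax => a xa; case: (xtot _ _ xa xi) => [ai|ia].
  by right; apply: le_trans ai (valP b).
exact: (bx (exist _ a ia)).
Qed.

Definition restr (x : X) (xi : idx_chain x i) : Xi :=
  Index (restr_map_subproof x) (restr_chain_subproof xi).

Definition agree (x y : X) : Prop :=
  [/\ idx_chain x i /\ idx_chain y i,
      idx_chain x `&` [set k | (k <= i)%O] = idx_chain y `&` [set k | (k <= i)%O] &
      forall k, ~~ (i <= k)%O -> idx_map x k = idx_map y k].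

Definition agree_l (x y : X) (h : agree x y) : idx_chain x i :=
  let: And3 (conj xi _) _ _ := h in xi.
Definition agree_r (x y : X) (h : agree x y) : idx_chain y i :=
  let: And3 (conj _ yi) _ _ := h in yi.

Lemma agree_refl x : idx_chain x i -> agree x x.
Proof. by []. Qed.

Lemma agree_sym x y : agree x y -> agree y x.
Proof. by case=> -[xi yi] e h; split=> // k /h. Qed.

Lemma agree_trans x y z : agree x y -> agree y z -> agree x z.
Proof.
case=> -[xi yi] e h [[_ zi] e' h']; split; rewrite ?e //.
by move=> k ik; rewrite h // h'.
Qed.

Section Glue.
Variables (s : Xi) (x : X) (xi : idx_chain x i).

Definition glue_map (k : P) : N :=
  if pselect (i <= k)%O is left h then idx_map s (exist _ k h) else idx_map x k.

Definition glue_chain : set P :=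
  (idx_chain x `&` [set k | (k <= i)%O]) `|` (val @` idx_chain s).

Lemma idx_chain_bot : idx_chain s (exist _ i (lexx i)).
Proof.
have /maximal_chainsP[_ smax] := idx_chainP s.
by apply: smax => a _; left; exact: (valP a).
Qed.

Lemma glue_map_up k (h : (i <= k)%O) : glue_map k = idx_map s (exist _ k h).
Proof.
rewrite /glue_map; case: pselect => // h'.
by congr (idx_map s _); exact: val_inj.
Qed.

Lemma glue_map_off k : ~~ (i <= k)%O -> glue_map k = idx_map x k.
Proof. by rewrite /glue_map => ik; case: pselect => // h; rewrite h in ik. Qed.

Lemma glue_chain_up k (h : (i <= k)%O) :
  glue_chain k <-> idx_chain s (exist _ k h).
Proof.
split=> [[[xk ki]|[[l il] sl lk]]|sk].
- have ek : i = k by apply: le_anti; rewrite h.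
  suff -> : exist _ k h = exist _ i (lexx i) :> up i by exact: idx_chain_bot.
  exact: val_inj.
- suff -> : exist _ k h = exist _ l il :> up i by [].
  exact: val_inj.
- by right; exists (exist _ k h).
Qed.

Lemma glue_chain_off k : ~~ (i <= k)%O ->
  glue_chain k <-> idx_chain x k /\ (k <= i)%O.
Proof.
move=> ik; split=> [[//|[l _ lk]]|]; last by left.
by move: ik; rewrite -lk (valP l).
Qed.

Fact glue_map_subproof : fin_supp glue_map.
Proof.
pose A := (val @` [set a | idx_map s a != \bot%O]) `|` [set a | idx_map x a != \bot%O].
have Afin : finite_set A.
  by rewrite /A finite_setU; split; [apply: finite_image|]; exact: idx_mapP.
apply: sub_finite_set Afin => k /=; rewrite /glue_map /A.
case: pselect => [h nz|_ nz]; last by right.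
by left; exists (exist _ k h).
Qed.

Fact glue_chain_subproof : maximal_chains P glue_chain.
Proof.
have /maximal_chainsP[xtot xmax] := idx_chainP x.
have /maximal_chainsP[stot smax] := idx_chainP s.
apply/maximal_chainsP; split.
  move=> a b [[xa ai]|[{}a sa <-]] [[xb bi]|[{}b sb <-]].
  - exact: xtot.
  - by left; apply: le_trans ai (valP b).
  - by right; apply: le_trans bi (valP a).
  - exact: stot.
move=> b bA; have Ai : glue_chain i by left; split=> //=.
case: (bA _ Ai) => [bi|ib]; last first.
  apply/(glue_chain_up ib); apply: smax => a sa.
  by apply: (bA (val a)); right; exists a.
left; split=> //; apply: xmax => a xa; case: (xtot _ _ xa xi) => [ai|ia].
  by apply: bA; left.
by left; apply: le_trans ia.
Qed.

Definition glue : X := Index glue_map_subproof glue_chain_subproof.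

Lemma glue_i : idx_chain glue i.
Proof. by left; split=> //=. Qed.

Lemma agree_glue : agree glue x.
Proof.
split=> [||k ik]; [by split; first exact: glue_i| |exact: glue_map_off].
apply/seteqP; split=> k /= [Ak ki]; split=> //; last by left.
case: Ak => [[]//|[l sl lk]]; suff -> : k = i by [].
by apply/le_anti; rewrite ki -lk (valP l).
Qed.

Lemma restr_glue h : restr (x := glue) h = s.
Proof.
apply: index_eq => [k|].
  have := glue_map_up (valP k); rewrite /restr /idx_map /= => ->.
  by congr (val s.1 _); exact: val_inj.
apply/seteqP; split=> -[k ik] /=; rewrite /idx_chain /=.
  by move/(glue_chain_up ik).
by move=> sk; apply/(glue_chain_up ik).
Qed.
End Glue.

Lemma glue_restr x y (xi : idx_chain x i) (yi : idx_chain y i) :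
  agree y x -> glue (restr yi) xi = y.
Proof.
case=> _ e h; apply: index_eq => [k|].
  have [ik|ik] := boolP (i <= k)%O; first exact: (glue_map_up _ _ ik).
  by rewrite [LHS](glue_map_off _ _ ik) h.
have /maximal_chainsP[ytot _] := idx_chainP y.
apply/seteqP; split=> k.
  by case=> [|[l yl <-]//]; rewrite -e => -[].
move=> yk; case: (ytot _ _ yk yi) => [ki|ik]; last by apply/(glue_chain_up _ _ ik).
by left; rewrite -e.
Qed.

Lemma restr_irr x (h h' : idx_chain x i) : restr h = restr h'.
Proof. by congr restr; exact: Prop_irrelevance. Qed.

Lemma glue_inj x (xi : idx_chain x i) : injective (fun s => glue s xi).
Proof.
by move=> s t e; rewrite -(restr_glue (glue_i s xi)) -(restr_glue (glue_i t xi));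
   move: (glue_i s xi) (glue_i t xi); rewrite e => h h'; exact: restr_irr.
Qed.
End Restriction.

Section Psi.
Variables (dN : Order.disp_t) (N : bOrderType dN) (K : fieldType).
Variables (d : Order.disp_t) (P : porderType d).
Notation X := (index N P).
Notation Xup i := (index N (up i)).
Notation Q := (cfm X K).

Definition psi_fun (i : P) (a : cfm (Xup i) K) (x y : X) : K :=
  if pselect (agree i x y) is left h
  then a (restr (agree_l h)) (restr (agree_r h)) else 0.

Lemma psi_fun_agree i a x y (xi : idx_chain x i) (yi : idx_chain y i) :
  agree i x y -> psi_fun a x y = a (restr xi) (restr yi).
Proof.
move=> xy; rewrite /psi_fun; case: pselect => // h.
by congr (a _ _); exact: restr_irr.
Qed.

Lemma psi_fun_nagree i (a : cfm (Xup i) K) x y : ~ agree i x y -> psi_fun a x y = 0.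
Proof. by rewrite /psi_fun; case: pselect. Qed.

Fact psi_subproof i (a : cfm (Xup i) K) : column_finite (psi_fun a).
Proof.
move=> y; have [yi|nyi] := pselect (idx_chain y i).
  have fa := finite_image (fun s => glue s yi) (cfm_finite a (restr yi)).
  apply: sub_finite_set fa => x /= nz.
  have [xy|nxy] := pselect (agree i x y); last first.
    by rewrite psi_fun_nagree ?eqxx in nz.
  rewrite (psi_fun_agree _ (agree_l xy) yi xy) in nz.
  by exists (restr (agree_l xy)) => //; exact: glue_restr.
apply: sub_finite_set (finite_set0 X) => x /=.
by rewrite psi_fun_nagree ?eqxx // => /agree_r.
Qed.

Definition psi (i : P) (a : cfm (Xup i) K) : Q := Cfm (psi_subproof a).

Definition Hi (i : P) : set Q :=
  if `[< maximal_element i >]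
  then [set k *: psi (1 : cfm (Xup i) K) | k in [set: K]]
  else @psi i @` finite_rows (X := Xup i) (K := K).

(* H(P,J), the sum of the subspaces [Hi j] over [j] in [J]. *)
Definition HJ (J : set P) : set Q :=
  [set a | exists s : seq Q,
     (forall b, b \in s -> exists2 j, J j & Hi j b) /\ a = \sum_(b <- s) b].

Lemma psi_agree i a x y (xi : idx_chain x i) (yi : idx_chain y i) :
  agree i x y -> psi a x y = a (restr xi) (restr yi).
Proof. exact: psi_fun_agree. Qed.

Lemma psi_neq0 i (a : cfm (Xup i) K) x y : psi a x y != 0 -> agree i x y.
Proof.
by move=> nz; apply: contrapT => /(psi_fun_nagree a) h; move: nz; rewrite [psi _ _ _]h eqxx.
Qed.

Lemma psi_scale i k (a : cfm (Xup i) K) : k *: psi a = psi (k *: a).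
Proof.
apply: cfmP => x y; have [xy|nxy] := pselect (agree i x y).
  by rewrite (psi_agree _ (agree_l xy) (agree_r xy)) // -[LHS]/(k * psi a x y)
    (psi_agree _ (agree_l xy) (agree_r xy)).
by rewrite -[LHS]/(k * psi_fun a x y) -[RHS]/(psi_fun _ _ _) !psi_fun_nagree ?mulr0.
Qed.

Lemma psi1E i x y : psi (1 : cfm (Xup i) K) x y = ((x == y) && `[< idx_chain x i >])%:R.
Proof.
have [xy|nxy] := pselect (agree i x y).
  rewrite (psi_agree _ (agree_l xy) (agree_r xy)) // -[LHS]cfm1E.
  rewrite (asboolT (agree_l xy)) andbT; congr (nat_of_bool _)%:R.
  apply/eqP/eqP => [e|exy]; last first.
    by move: (agree_l xy) (agree_r xy); rewrite -exy => h h'; exact: restr_irr.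
  rewrite -(glue_restr (agree_l xy) (agree_l xy)) //; last exact: agree_refl (agree_l xy).
  rewrite e -[RHS](glue_restr (agree_l xy) (agree_r xy)) //; exact: agree_sym.
rewrite -[LHS]/(psi_fun _ _ _) psi_fun_nagree //.
case: eqP => //= exy; case: asboolP => // xi; case: nxy.
by rewrite -exy; exact: agree_refl.
Qed.

Lemma psi_glue_up i j (b : cfm (Xup j) K) (ij : (i <= j)%O) (s t : Xup i)
    x y (xi : idx_chain x i) (yi : idx_chain y i) :
  psi b (glue s xi) (glue t xi) = psi b (glue s yi) (glue t yi).
Proof.
have up_chain (u : Xup i) z w (zi : idx_chain z i) (wi : idx_chain w i) k :
    (i <= k)%O -> idx_chain (glue u zi) k -> idx_chain (glue u wi) k.
  by move=> ik /(glue_chain_up u z ik) h; apply/(glue_chain_up u w ik).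
have tr z w (zi : idx_chain z i) (wi : idx_chain w i) :
    agree j (glue s zi) (glue t zi) -> agree j (glue s wi) (glue t wi).
  case=> -[sj tj] /seteqP[e1 e2] h; split.
  - by split; [exact: (up_chain _ _ _ _ wi _ ij sj)|exact: (up_chain _ _ _ _ wi _ ij tj)].
  - apply/seteqP; split=> k /= [Ak kj]; split=> //.
      have [ik|ik] := boolP (i <= k)%O.
        have /e1[tk _] : (idx_chain (glue s zi) `&` [set k | (k <= j)%O]) k.
          by split=> //; exact: (up_chain _ _ _ _ zi _ ik Ak).
        exact: (up_chain _ _ _ _ wi _ ik tk).
      by apply/(glue_chain_off _ _ ik)/(glue_chain_off s _ ik).
    have [ik|ik] := boolP (i <= k)%O.
      have /e2[tk _] : (idx_chain (glue t zi) `&` [set k | (k <= j)%O]) k.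
        by split=> //; exact: (up_chain _ _ _ _ zi _ ik Ak).
      exact: (up_chain _ _ _ _ wi _ ik tk).
    by apply/(glue_chain_off _ _ ik)/(glue_chain_off t _ ik).
  - move=> k jk; have [ik|ik] := boolP (i <= k)%O.
      by have := h _ jk; rewrite /idx_map /= !(glue_map_up _ _ ik).
    by rewrite /idx_map /= !(glue_map_off _ _ ik).
have restrE (u : Xup i) (h : idx_chain (glue u xi) j) (h' : idx_chain (glue u yi) j) :
    restr h = restr h'.
  apply: index_eq => [k|].
    have ik : (i <= val k)%O by apply: le_trans ij (valP k).
    by rewrite -[LHS]/(glue_map u x (val k)) -[RHS]/(glue_map u y (val k))
      !(glue_map_up _ _ ik).
  apply/seteqP; split=> k hk; have ik : (i <= val k)%O := le_trans ij (valP k).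
    exact: (up_chain _ _ _ _ yi _ ik hk).
  exact: (up_chain _ _ _ _ xi _ ik hk).
have [xy|nxy] := pselect (agree j (glue s xi) (glue t xi)).
  have xy' := tr _ _ _ yi xy.
  rewrite (psi_agree _ (agree_l xy) (agree_r xy)) //.
  rewrite (psi_agree _ (agree_l xy') (agree_r xy')) //.
  by congr (b _ _); exact: restrE.
by rewrite [LHS]psi_fun_nagree // [RHS]psi_fun_nagree // => /tr.
Qed.

Lemma psi_image i (M : Q) :
    (forall x z, M x z != 0 -> agree i x z) ->
    (forall x y (xi : idx_chain x i) (yi : idx_chain y i) s t,
       M (glue s xi) (glue t xi) = M (glue s yi) (glue t yi)) ->
  exists2 a : cfm (Xup i) K, M = psi a &
    forall s t, a s t != 0 -> exists x (xi : idx_chain x i),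
      a s t = M (glue s xi) (glue t xi).
Proof.
move=> M0 Minv; have [[x0 xi0]|nx] := pselect (exists x : X, idx_chain x i); last first.
  exists 0; last by move=> s t; rewrite -[X in X != _]/(0 : K) eqxx.
  apply: cfmP => x y.
  have nxy : ~ agree i x y by move=> h; apply: nx; exists x; exact: agree_l h.
  rewrite -[RHS]/(psi_fun _ _ _) psi_fun_nagree //.
  by apply/eqP; apply: contrapT => /negP /M0.
have fa : column_finite (fun s t => M (glue s xi0) (glue t xi0)).
  move=> t.
  apply: (finite_preimage (f := fun s => glue s xi0)
    (B := [set x | M x (glue t xi0) != 0])); last exact: cfm_finite.
  by move=> s s' _ _; exact: glue_inj.
exists (Cfm fa); last by move=> s t _; exists x0, xi0.
apply: cfmP => x y; have [xy|nxy] := pselect (agree i x y).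
  rewrite (psi_agree _ (agree_l xy) (agree_r xy)) //.
  rewrite -[RHS]/(M (glue _ xi0) (glue _ xi0)) (Minv _ _ _ (agree_r xy)).
  rewrite !glue_restr //; exact: agree_refl (agree_r xy).
rewrite -[RHS]/(psi_fun _ _ _) psi_fun_nagree //.
by apply/eqP; apply: contrapT => /negP /M0.
Qed.

Lemma cfm_mul_neq0 (Y : choiceType) (a b : cfm Y K) x z :
  cfm_fun (a * b) x z != 0 -> exists y, a x y != 0 /\ b y z != 0.
Proof.
move=> nz; apply: contrapT => nex; case/negP: nz; apply/eqP.
rewrite -[LHS]/(\sum_(y \in [set: Y]) a x y * b y z) fsbig1 // => y _.
apply/eqP; apply: contrapT => /negP; rewrite mulf_eq0 negb_or => /andP[ay yb].
by apply: nex; exists y.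
Qed.

Lemma sum_glue i x (xi : idx_chain x i) (f : X -> K) :
    (forall y, f y != 0 -> agree i y x) ->
  \sum_(y \in [set: X]) f y = \sum_(s \in [set: Xup i]) f (glue s xi).
Proof.
move=> f0; rewrite -(fsbig_image setT (fun s => glue s xi) f); last first.
  by move=> s t _ _; exact: glue_inj.
apply/esym/fsbig_widen => // y [_ yN]; apply/eqP; apply: contrapT => /negP /f0 yx.
by apply: yN; exists (restr (agree_l yx)) => //; exact: glue_restr.
Qed.

Lemma psi_mul_invariant i j j' (a : cfm (Xup j) K) (b : cfm (Xup j') K) :
    (i <= j)%O -> (i <= j')%O -> (j = i \/ j' = i) ->
  forall x y (xi : idx_chain x i) (yi : idx_chain y i) s t,
    cfm_fun (psi a * psi b) (glue s xi) (glue t xi) = cfm_fun (psi a * psi b) (glue s yi) (glue t yi).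
Proof.
move=> ij ij' ji x y xi yi s t.
have E z (zi : idx_chain z i) : cfm_fun (psi a * psi b) (glue s zi) (glue t zi) =
    \sum_(u \in [set: Xup i])
      psi a (glue s zi) (glue u zi) * psi b (glue u zi) (glue t zi).
  apply: (sum_glue zi
    (f := fun w => psi a (glue s zi) w * psi b w (glue t zi))) => w.
  rewrite mulf_eq0 negb_or => /andP[/psi_neq0 aw /psi_neq0 bw].
  have sz : agree i (glue s zi) z by exact: agree_glue.
  have tz : agree i (glue t zi) z by exact: agree_glue.
  case: ji => e; [move: aw|move: bw]; rewrite e => aw'.
    exact: agree_trans (agree_sym aw') sz.
  exact: agree_trans aw' tz.
rewrite !E; apply: eq_fsbigr => u _.
by rewrite (psi_glue_up a ij s u xi yi) (psi_glue_up b ij' u t xi yi).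
Qed.

Lemma agree_down i j (x y : X) : (i <= j)%O -> idx_chain x i -> agree j x y -> agree i x y.
Proof.
move=> ij xi [[xj yj] /seteqP[e1 e2] h]; split.
- by split=> //; have [] := e1 i (conj xi ij).
- apply/seteqP; split=> k /= [Ak ki]; split=> //.
    by have [] := e1 k (conj Ak (le_trans ki ij)).
  by have [] := e2 k (conj Ak (le_trans ki ij)).
- by move=> k ik; apply: h; apply: contra ik; exact: le_trans.
Qed.

Lemma psi_rows i j (a : cfm (Xup i) K) (b : cfm (Xup j) K) :
    (i <= j)%O -> finite_rows a ->
  exists2 c : cfm (Xup i) K, finite_rows c & psi a * psi b = psi c.
Proof.
move=> ij fa; have [||c e c0] := @psi_image i (psi a * psi b).
- move=> x z /cfm_mul_neq0[y [/psi_neq0 xy /psi_neq0 yz]].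
  exact: agree_trans xy (agree_down ij (agree_r xy) yz).
- by apply: psi_mul_invariant => //; left.
exists c => //; apply: sub_finite_set fa => s /= [t nz].
have [x [xi E]] := c0 _ _ nz; rewrite {}E in nz.
have [y [ay _]] := cfm_mul_neq0 nz; have xy := psi_neq0 ay.
rewrite (psi_agree _ (agree_l xy) (agree_r xy)) // restr_glue in ay.
by exists (restr (agree_r xy)).
Qed.

Lemma psi_cols i j (a : cfm (Xup i) K) (b : cfm (Xup j) K) :
    (i <= j)%O -> finite_rows a ->
  exists2 c : cfm (Xup i) K, finite_rows c & psi b * psi a = psi c.
Proof.
move=> ij fa; have [||c e c0] := @psi_image i (psi b * psi a).
- move=> x z /cfm_mul_neq0[y [/psi_neq0 xy /psi_neq0 yz]].
  exact: agree_sym (agree_trans (agree_sym yz) (agree_down ij (agree_l yz) (agree_sym xy))).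
- by apply: psi_mul_invariant => //; right.
have [[x0 xi0]|nx] := pselect (exists x : X, idx_chain x i); last first.
  exists c => //; apply: sub_finite_set (finite_set0 _) => s /= [t /c0[x [xi _]]].
  by case: nx; exists x.
exists c => //.
pose U := [set u | exists t, a u t != 0].
have fV : finite_set (\bigcup_(u in U) [set s | psi b (glue s xi0) (glue u xi0) != 0]).
  apply: bigcup_finite => // u _.
  apply: (finite_preimage (f := fun s => glue s xi0)
    (B := [set x | psi b x (glue u xi0) != 0])); last exact: cfm_finite.
  by move=> s s' _ _; exact: glue_inj.
apply: sub_finite_set fV => s /= [t nz].
have [x [xi E]] := c0 _ _ nz; rewrite {}E in nz.
have [y [bsy ayt]] := cfm_mul_neq0 nz; have yt := psi_neq0 ayt.
have yx := agree_trans yt (agree_glue t xi).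
exists (restr (agree_l yt)).
  rewrite (psi_agree _ (agree_l yt) (agree_r yt)) // in ayt.
  by exists (restr (agree_r yt)).
by rewrite /= (psi_glue_up b ij _ _ xi0 xi) glue_restr.
Qed.

Lemma psi_incomparable i j (a : cfm (Xup i) K) (b : cfm (Xup j) K) :
  ~~ (i <= j)%O -> ~~ (j <= i)%O -> psi a * psi b = 0.
Proof.
move=> ij ji; apply: cfmP => x z; apply/eqP; apply: contrapT => /negP.
move=> /cfm_mul_neq0[y [/psi_neq0/agree_r yi /psi_neq0/agree_l yj]].
have [ytot _] := idx_chainP y.
by case: (ytot _ _ yi yj); apply/negP.
Qed.

Lemma HiE i a : Hi i a ->
  (maximal_element i /\ exists k : K, a = k *: psi (1 : cfm (Xup i) K)) \/
  (~ maximal_element i /\ exists2 b : cfm (Xup i) K, finite_rows b & a = psi b).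
Proof.
rewrite /Hi; case: asboolP => mi [b hb <-]; first by left; split=> //; exists b.
by right; split=> //; exists b.
Qed.

Lemma Hi_psi i a : Hi i a -> exists b : cfm (Xup i) K, a = psi b.
Proof.
case/HiE => -[_]; last by case=> b _ ->; exists b.
by case=> k ->; rewrite psi_scale; eexists.
Qed.

Lemma psi1_idem i (e := psi (1 : cfm (Xup i) K)) : e * e = e.
Proof.
rewrite /e; apply: cfmP => x z.
have A0 y : y \notin [fset z]%fset -> psi (1 : cfm (Xup i) K) y z = 0.
  by rewrite inE psi1E => /negPf ->.
rewrite [LHS](cfm_mulE_fset _ _ A0) big_seq_fset1 !psi1E eqxx /=.
by case: eqP => [->|_]; rewrite ?mul0r //; case: asboolP; rewrite ?mulr1 ?mulr0.
Qed.

Lemma scalel_cfm (Y : choiceType) k (a b : cfm Y K) : (k *: a) * b = k *: (a * b).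
Proof.
apply: cfmP => x y; have [B Bb] := cfm_eq0 b y.
rewrite [LHS](cfm_mulE_fset _ _ Bb) -[RHS]/(k * cfm_fun (a * b) x y).
rewrite (cfm_mulE_fset _ _ Bb) mulr_sumr; apply: eq_bigr => z _.
by rewrite mulrA.
Qed.

Lemma scaler_cfm (Y : choiceType) k (a b : cfm Y K) : a * (k *: b) = k *: (a * b).
Proof.
apply: cfmP => x y; have [B Bb] := cfm_eq0 b y.
have Bkb z : z \notin B -> cfm_fun (k *: b) z y = 0.
  by move=> /Bb bz; rewrite -[LHS]/(k * b z y) bz mulr0.
rewrite [LHS](cfm_mulE_fset _ _ Bkb) -[RHS]/(k * cfm_fun (a * b) x y).
rewrite (cfm_mulE_fset _ _ Bb) mulr_sumr; apply: eq_bigr => z _.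
by rewrite mulrCA.
Qed.

Lemma Hi_mul_le i j a b : (i <= j)%O -> Hi i a -> Hi j b -> Hi i (a * b) /\ Hi i (b * a).
Proof.
move=> ij Ha Hb; case/HiE: (Ha) => -[mi].
  have eji := mi _ ij; subst j; move=> [k ea].
  case/HiE: Hb => -[// _ [l ->]]; rewrite ea /Hi asboolT //.
  rewrite !scalel_cfm !scaler_cfm psi1_idem !scalerA.
  by split; [exists (k * l)|exists (l * k)].
move=> [c fc ->]; have [e ->] := Hi_psi Hb.
rewrite /Hi asboolF //; split.
  by have [f ff ->] := psi_rows e ij fc; exists f.
by have [f ff ->] := psi_cols e ij fc; exists f.
Qed.

Lemma HJ0 J : HJ J 0.
Proof. by exists [::]; split=> //; rewrite big_nil. Qed.

Lemma HJD J a b : HJ J a -> HJ J b -> HJ J (a + b).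
Proof.
move=> [s [hs ->]] [t [ht ->]]; exists (s ++ t); rewrite big_cat; split=> // c.
by rewrite mem_cat => /orP[/hs|/ht].
Qed.

Lemma HJ_sum J (T : eqType) (s : seq T) (F : T -> Q) :
  (forall x, x \in s -> HJ J (F x)) -> HJ J (\sum_(x <- s) F x).
Proof.
move=> h; rewrite big_seq; apply: big_ind => //; [exact: HJ0|].
by move=> a b; exact: HJD.
Qed.

Lemma Hi_HJ (J : set P) j a : J j -> Hi j a -> HJ J a.
Proof.
move=> Jj ja; exists [:: a]; rewrite big_seq1; split=> // b.
by rewrite inE => /eqP ->; exists j.
Qed.

Lemma HiZ i k a : Hi i a -> Hi i (k *: a).
Proof.
move=> Ha; case/HiE: (Ha) => -[mi].
  by move=> [l ->]; rewrite /Hi asboolT //; exists (k * l) => //; rewrite scalerA.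
move=> [b fb ->]; rewrite /Hi asboolF //; exists (k *: b); last by rewrite psi_scale.
apply: sub_finite_set fb => x /= [y]; rewrite -[cfm_fun (k *: b) x y]/(k * b x y).
by rewrite mulf_eq0 negb_or => /andP[_ nz]; exists y.
Qed.

Lemma HJZ J k a : HJ J a -> HJ J (k *: a).
Proof.
move=> [s [hs ->]]; rewrite scaler_sumr; apply: HJ_sum => b /hs[j Jj jb].
by apply: Hi_HJ Jj _; exact: HiZ.
Qed.

Lemma HJM (a b : Q) : HJ setT a -> HJ setT b -> HJ setT (a * b).
Proof.
move=> [s [hs ->]] [t [ht ->]]; rewrite mulr_suml; apply: HJ_sum => x /hs[i _ ix].
rewrite mulr_sumr; apply: HJ_sum => y /ht[j _ jy].
have [ij|ij] := boolP (i <= j)%O.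
  by apply: (@Hi_HJ _ i) => //; have [] := Hi_mul_le ij ix jy.
have [ji|ji] := boolP (j <= i)%O.
  by apply: (@Hi_HJ _ j) => //; have [] := Hi_mul_le ji jy ix.
have [u ->] := Hi_psi ix; have [v ->] := Hi_psi jy.
by rewrite psi_incomparable //; exact: HJ0.
Qed.

(* The identity matrix when [P] is nonempty, because maximal chains are then
   nonempty (see [frakB_one_nonempty]). For empty [P] the algebra B(P) is zero
   whereas Q(P) is not; this definition then gives the identity 0 of B(P). *)
Fact frakB_one_subproof :
  column_finite (fun x y : X => ((x == y) && `[< idx_chain x !=set0 >])%:R : K).
Proof.
apply: cfm_fset => y; exists [fset y]%fset => x.
by rewrite inE => /negPf ->.
Qed.
Definition frakB_one : Q := Cfm frakB_one_subproof.

Lemma frakB_one_nonempty (i : P) : frakB_one = 1.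
Proof.
apply: cfmP => x y; rewrite -[LHS]/(_ && _)%:R -[RHS]cfm1E.
have -> : `[< idx_chain x !=set0 >] = true; last by rewrite andbT.
apply: asboolT; apply: contrapT => x0.
have /maximal_chainsP[_ xmax] := idx_chainP x.
apply: (x0); exists i; apply: xmax => a xa.
by case: x0; exists a.
Qed.

Lemma maximal_in_chain (x : X) : finite_cofinal P -> idx_chain x !=set0 ->
  exists2 m, maximal_element m & idx_chain x m.
Proof.
move=> [F Ffin Fcof] [a0 xa0]; have /maximal_chainsP[xtot xmax] := idx_chainP x.
have [f fub] : exists f, forall a, idx_chain x a -> (a <= f)%O.
  apply: contrapT => nf.
  have /choice[g gP] : forall f, exists a, idx_chain x a /\ ~~ (a <= f)%O.
    move=> f; apply: contrapT => nex; apply: nf; exists f => a xa.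
    by apply: contrapT => /negP af; apply: nex; exists a.
  have ub (s : seq P) : exists2 a, idx_chain x a & forall f, f \in s -> (g f <= a)%O.
    elim: s => [|f s [a xa ha]]; first by exists a0.
    have [gf _] := gP f; case: (xtot _ _ xa gf) => h.
      exists (g f) => // k; rewrite inE => /orP[/eqP -> //|/ha ka].
      exact: le_trans ka h.
    by exists a => // k; rewrite inE => /orP[/eqP -> //|/ha].
  have [a xa ha] := ub (fset_set F); have [f Ff af] := Fcof a.
  have [_ /negP] := gP f; apply; apply: le_trans af; apply: ha.
  by rewrite in_fset_set // inE.
have top g : (f <= g)%O -> idx_chain x g.
  by move=> fg; apply: xmax => a /fub af; right; exact: le_trans fg.
exists f; last exact: top.
by move=> g fg; apply: le_anti; rewrite fg (fub _ (top _ fg)).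
Qed.

Lemma frakB_oneP : finite_cofinal P -> HJ setT frakB_one.
Proof.
move=> Pcof; have [F Ffin Fcof] := Pcof.
have Mfin : finite_set (@maximal_element d P).
  apply: sub_finite_set Ffin => m mm; have [f Ff mf] := Fcof m.
  by rewrite -(mm _ mf).
pose S := fset_set (@maximal_element d P).
have memS m : m \in S -> maximal_element m by rewrite in_fset_set // inE.
have -> : frakB_one = \sum_(m <- S) psi (1 : cfm (Xup m) K).
  apply: cfmP => x y; rewrite -[LHS]/(_ && _)%:R.
  have -> (s : seq P) : cfm_fun (\sum_(m <- s) psi (1 : cfm (Xup m) K)) x y =
      \sum_(m <- s) ((x == y) && `[< idx_chain x m >])%:R.
    elim: s => [|m s IH]; first by rewrite !big_nil.
    rewrite !big_cons -IH -psi1E //.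
  case: eqP => [_|_] /=; last by rewrite big1.
  case: asboolP => [/(maximal_in_chain Pcof)[m mm xm]|nx]; last first.
    by rewrite big1 // => m _; case: asboolP => // xm; case: nx; exists m.
  have mS : m \in S by rewrite in_fset_set // inE.
  rewrite (big_fsetD1 m) //= (asboolT xm) big_seq big1 ?addr0 // => k.
  rewrite !inE => /andP[km /memS mk]; case: asboolP => // xk.
  have [xtot _] := idx_chainP x; case/eqP: km.
  by case: (xtot _ _ xk xm) => [/mk ->|/mm].
apply: HJ_sum => m /memS mm; apply: (@Hi_HJ _ m) => //.
by rewrite /Hi asboolT //; exists 1 => //; rewrite scale1r.
Qed.

Lemma frakB_one_l a : HJ setT a -> frakB_one * a = a.
Proof.
move=> [s [hs ->]]; rewrite mulr_sumr; rewrite [LHS]big_seq [RHS]big_seq.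
apply: eq_bigr => b /hs[i _ /Hi_psi[c ->]].
apply: cfmP => x y; have [A Ac] := cfm_eq0 (psi c) y.
have Ax z : z \notin (x |` A)%fset -> psi c z y = 0.
  by rewrite !inE negb_or => /andP[_ /Ac].
rewrite [LHS](cfm_mulE_fset _ _ Ax) (big_fsetD1 x) /= ?inE ?eqxx //.
rewrite big_seq big1 ?addr0 => [|z]; last first.
  rewrite !inE => /andP[zx _]; rewrite -[frakB_one x z]/(_ && _)%:R.
  by rewrite eq_sym (negPf zx) mul0r.
rewrite -[frakB_one x x]/(_ && _)%:R eqxx /=; case: asboolP => [_|nx]; first by rewrite mul1r.
rewrite mul0r; apply/esym/eqP; apply: contrapT => /negP /psi_neq0 /agree_l xi.
by apply: nx; exists i.
Qed.

Lemma frakB_one_r a : HJ setT a -> a * frakB_one = a.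
Proof.
move=> [s [hs ->]]; rewrite mulr_suml; rewrite [LHS]big_seq [RHS]big_seq.
apply: eq_bigr => b /hs[i _ /Hi_psi[c ->]].
apply: cfmP => x y.
have Ay z : z \notin [fset y]%fset -> frakB_one z y = 0.
  by rewrite inE -[frakB_one z y]/(_ && _)%:R => /negPf ->.
rewrite [LHS](cfm_mulE_fset _ _ Ay) big_seq_fset1.
rewrite -[frakB_one y y]/(_ && _)%:R eqxx /=; case: asboolP => [_|nx]; first by rewrite mulr1.
rewrite mulr0; apply/esym/eqP; apply: contrapT => /negP /psi_neq0 /agree_r yi.
by apply: nx; exists i.
Qed.
End Psi.

(* B(P) = H(P,P). [Pcof] does not affect the carrier: it is there because it
   provides the identity of the ring. *)
Definition frakB (dN : Order.disp_t) (N : bOrderType dN) (K : fieldType)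
    (d : Order.disp_t) (P : porderType d) (Pcof : finite_cofinal P) : Type :=
  set_type (HJ (N := N) (K := K) (P := P) setT).

Section FrakB.
Variables (dN : Order.disp_t) (N : bOrderType dN) (K : fieldType).
Variables (d : Order.disp_t) (P : porderType d) (Pcof : finite_cofinal P).
Notation Q := (cfm (index N P) K).
Notation B := (frakB N K Pcof).

HB.instance Definition _ := Choice.on B.
HB.instance Definition _ := SubChoice.on B.

Definition frakB_val (a : B) : Q := val a.
Definition FrakB (a : Q) (ha : HJ setT a) : B := exist _ a (mem_set ha).

Lemma frakB_val_inj : injective frakB_val.
Proof. exact: val_inj. Qed.

Lemma frakBP (a : B) : HJ setT (frakB_val a).
Proof. by have /set_mem := valP a. Qed.

Fact frakB_opp_subproof (a : B) : HJ setT (- frakB_val a).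
Proof. by rewrite -scaleN1r; apply/HJZ/frakBP. Qed.

Definition frakB0 : B := FrakB (@HJ0 _ N K _ P setT).
Definition frakB1 : B := FrakB (frakB_oneP N K Pcof).
Definition frakB_opp (a : B) : B := FrakB (frakB_opp_subproof a).
Definition frakB_add (a b : B) : B := FrakB (HJD (frakBP a) (frakBP b)).
Definition frakB_mul (a b : B) : B := FrakB (HJM (frakBP a) (frakBP b)).

Fact frakB_addA : associative frakB_add.
Proof. by move=> a b c; apply: frakB_val_inj; exact: addrA. Qed.
Fact frakB_addC : commutative frakB_add.
Proof. by move=> a b; apply: frakB_val_inj; exact: addrC. Qed.
Fact frakB_add0 : left_id frakB0 frakB_add.
Proof. by move=> a; apply: frakB_val_inj; exact: add0r. Qed.
Fact frakB_addN : left_inverse frakB0 frakB_opp frakB_add.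
Proof. by move=> a; apply: frakB_val_inj; exact: addNr. Qed.

HB.instance Definition _ :=
  GRing.isZmodule.Build B frakB_addA frakB_addC frakB_add0 frakB_addN.

Fact frakB_mulA : associative frakB_mul.
Proof. by move=> a b c; apply: frakB_val_inj; exact: mulrA. Qed.
Fact frakB_mul1l : left_id frakB1 frakB_mul.
Proof. by move=> a; apply: frakB_val_inj; exact/frakB_one_l/frakBP. Qed.
Fact frakB_mul1r : right_id frakB1 frakB_mul.
Proof. by move=> a; apply: frakB_val_inj; exact/frakB_one_r/frakBP. Qed.
Fact frakB_mulDl : left_distributive frakB_mul +%R.
Proof. by move=> a b c; apply: frakB_val_inj; exact: mulrDl. Qed.
Fact frakB_mulDr : right_distributive frakB_mul +%R.
Proof. by move=> a b c; apply: frakB_val_inj; exact: mulrDr. Qed.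

HB.instance Definition _ := GRing.Zmodule_isPzRing.Build B
  frakB_mulA frakB_mul1l frakB_mul1r frakB_mulDl frakB_mulDr.

Lemma frakB_val0 : frakB_val 0 = 0. Proof. by []. Qed.
Lemma frakB_valD a b : frakB_val (a + b) = frakB_val a + frakB_val b.
Proof. by []. Qed.
Lemma frakB_valM a b : frakB_val (a * b) = frakB_val a * frakB_val b.
Proof. by []. Qed.
Lemma frakB_val1 (i : P) : frakB_val 1 = 1.
Proof. exact: frakB_one_nonempty i. Qed.

Definition Psi (i : P) : set B :=
  [set b | HJ [set j | ~~ (i <= j)%O] (frakB_val b)].
End FrakB.
Arguments Psi {dN} N K {d P} Pcof i.

Definition Prim (R : pzRingType) : set (set R) :=
  [set I | right_primitive I].

(* [f] maps [P] into [S], and it is an isomorphism onto [S] ordered by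
   inclusion. *)
Definition order_isomorphism (d : Order.disp_t) (P : porderType d) (T : Type)
    (S : set (set T)) (f : P -> set T) : Prop :=
  set_bij [set: P] S f /\ forall i j, (i <= j)%O <-> f i `<=` f j.

(* Main.v *)
(* Row [x] of a matrix in H(I,j) vanishes as soon as the chain of [x] contains
   an [i] with [i] not below [j] and the map of [x] avoids finitely many values
   at [j]. Hence the rows of [b] in B(I) that are generic at [i] only see the
   summands of [b] in the H(I,j) with [i <= j], and on these rows [b] coincides
   with [psi c] for a unique [c]. This makes H(I,{i not <=}) the kernel of a ring
   morphism to CFM_{X(i<=)}(K), whose image contains all finite-row matrices, or
   consists of the scalar matrices if [i] is maximal; so this kernel is a
   primitive ideal.

   If [I] is artinian and [M] is a simple module, take [i] minimal such that
   H(I,i) does not annihilate [M]: the annihilator is then H(I,{i not <=}). If [S]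
   is a proper right ideal, take [i] minimal such that H(I,i) is not contained in
   [S]: an element of H(I,i) outside [S] with a single nonzero row generates a
   simple submodule of B(I)/S.

   If [c] is a strictly descending sequence in [I], let [T] be the intersection
   of the ideals H(I,{c n not <=}). Then B(I)/T has zero socle. Choosing
   idempotents [e n] in H(I,c n) with [e (n+1) * e n = e (n+1)], a maximal right
   ideal containing all [r] with [e n * r] in [T] for some [n] contains no [e n],
   and the annihilator of the corresponding simple module is not in the image
   of [Psi]. *)
Require Import Defs.
From HB Require Import structures.
From mathcomp Require Import all_boot all_order all_algebra.
From mathcomp Require Import generic_quotient ring_quotient finmap.
From mathcomp Require Import boolp classical_sets cardinality fsbigop.

Set Implicit Arguments.
Unset Strict Implicit.
Unset Printing Implicit Defensive.

Import Order.TTheory GRing.Theory.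

(** * Submodules as predicates, and socles relative to a submodule *)

Section Submodules.
Local Open Scope classical_set_scope.
Local Open Scope ring_scope.
Variables (R : pzRingType) (M : lmodType R).

Definition is_submodule (S : set M) : Prop :=
  S 0 /\ forall a x y, S x -> S y -> S (a *: x + y).

Definition submodule_pred (S : set M) (hS : is_submodule S) : {pred M} :=
  fun x => `[< S x >].

Fact submodule_pred_closed S (hS : is_submodule S) :
  submod_closed (submodule_pred hS).
Proof.
case: (hS) => S0 SD; split=> [|a x y]; first exact/asboolP.
by move=> /asboolP Sx /asboolP Sy; apply/asboolP/SD.
Qed.

HB.instance Definition _ S (hS : is_submodule S) :=
  GRing.isSubmodClosed.Build R M (submodule_pred hS) (submodule_pred_closed hS).

Definition Submodule S (hS : is_submodule S) : submodClosed M :=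
  submodule_pred hS.

Lemma mem_Submodule S (hS : is_submodule S) x : (x \in Submodule hS) <-> S x.
Proof. by split=> /asboolP. Qed.

Lemma cyclic_submodule (x : M) : is_submodule [set r *: x | r in [set: R]].
Proof.
split; first by exists 0 => //; rewrite scale0r.
by move=> a _ _ [r _ <-] [s _ <-]; exists (a * r + s) => //; rewrite scalerDl scalerA.
Qed.

Lemma simple_module_gen (x y : M) :
  simple_module M -> x != 0 -> exists r, y = r *: x.
Proof.
move=> [_ simM] x0; case: (simM (Submodule (cyclic_submodule x))) => h.
  case/eqP: x0; apply: h; apply/mem_Submodule.
  by exists 1 => //; rewrite scale1r.
by have /mem_Submodule[r _ <-] := h y; exists r.
Qed.

(* [y] generates a simple or zero submodule modulo [S] *)
Definition atomic_mod (S : set M) (y : M) : Prop :=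
  forall r, S (r *: y) \/ exists r', S (r' *: (r *: y) - y).

(** For a submodule [S] this is the preimage of the socle of the quotient by [S]. The form with
    representatives makes sense for every set and, as elements that vanish modulo [S] count as
    atomic, it is monotone in [S]. *)
Definition socle_mod (S : set M) : set M :=
  [set x | exists2 s : seq M, (forall y, y \in s -> atomic_mod S y) &
     S (x - \sum_(y <- s) y)].

Lemma sub_socle_mod S : S `<=` socle_mod S.
Proof. by move=> x Sx; exists [::] => //; rewrite big_nil subr0. Qed.

Lemma socle_mod_mono S T : S `<=` T -> socle_mod S `<=` socle_mod T.
Proof.
move=> ST x [s hs /ST xs]; exists s => // y /hs ay r.
by case: (ay r) => [/ST|[r' /ST]]; [left|right; exists r'].
Qed.

Lemma submoduleZ S a x : is_submodule S -> S x -> S (a *: x).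
Proof. by move=> [S0 SD] Sx; rewrite -[_ *: _]addr0; exact: SD. Qed.

Lemma submoduleD S x y : is_submodule S -> S x -> S y -> S (x + y).
Proof. by move=> [S0 SD] Sx Sy; rewrite -[x]scale1r; exact: SD. Qed.

Lemma submoduleN S x : is_submodule S -> S x -> S (- x).
Proof. by move=> hS Sx; rewrite -scaleN1r; exact: submoduleZ. Qed.

Lemma submoduleB S x y : is_submodule S -> S x -> S y -> S (x - y).
Proof. by move=> hS Sx Sy; apply: submoduleD => //; exact: submoduleN. Qed.

Lemma submodule_sum S (T : eqType) (s : seq T) (F : T -> M) : is_submodule S ->
  (forall y, y \in s -> S (F y)) -> S (\sum_(y <- s) F y).
Proof.
move=> hS h; rewrite big_seq; apply: big_ind => //; first by case: hS.
by move=> x y; exact: submoduleD.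
Qed.

Lemma atomic_mod_scale S a y : is_submodule S ->
  atomic_mod S y -> atomic_mod S (a *: y).
Proof.
move=> hS ay r; rewrite scalerA; case: (ay (r * a)) => [|[r' h]]; first by left.
by right; exists (a * r'); rewrite -scalerA -scalerBr; exact: submoduleZ.
Qed.

Lemma socle_mod_submodule S : is_submodule S -> is_submodule (socle_mod S).
Proof.
move=> hS; split; first by apply: sub_socle_mod; case: hS.
move=> a x y [s hs xs] [t ht yt]; exists ([seq a *: z | z <- s] ++ t).
  move=> z; rewrite mem_cat => /orP[/mapP[w /hs aw ->]|/ht //].
  exact: atomic_mod_scale.
rewrite big_cat big_map -scaler_sumr opprD addrACA -scalerBr.
by case: hS => _; apply.
Qed.

End Submodules.

(** * The socle of a quotient module, computed on representatives *)

Section Quotient.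
Local Open Scope classical_set_scope.
Local Open Scope ring_scope.
Variables (R : pzRingType) (M : lmodType R).
Variable N : submodClosed M.
Local Notation piN := (\pi_(quotmod N)%qT).
Local Notation S := [set x | x \in N].

Lemma pi_eq0 x : piN x = 0 <-> x \in N.
Proof.
rewrite -[x in x \in N]subr0.
have -> : 0 = piN 0 by rewrite !piE.
split=> [/eqP|h]; first by rewrite -Quotient.idealrBE.
by apply/eqP; rewrite -Quotient.idealrBE.
Qed.

Lemma piZ a x : a *: piN x = piN (a *: x).
Proof. exact: pi_scale. Qed.

Lemma piB x y : piN x - piN y = piN (x - y).
Proof.
rewrite -[- piN y]scaleN1r piZ; rewrite -[LHS]Defs.pi_add.
by rewrite scaleN1r.
Qed.

Lemma pi_sum (s : seq M) : piN (\sum_(y <- s) y) = \sum_(y <- s) piN y.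
Proof.
elim: s => [|y s IH]; last by rewrite !big_cons Defs.pi_add IH.
by rewrite !big_nil; apply/pi_eq0; exact: rpred0.
Qed.

(** An element of a simple submodule is recovered from each of its nonzero multiples; conversely, an
    atomic element outside [N] generates a simple submodule of the quotient. *)
Lemma socle_quotmod x : socle (piN x) <-> socle_mod S x.
Proof.
split=> [[s [hs e]]|[s hs xs]].
  exists [seq repr y | y <- s]; last first.
    apply/pi_eq0; rewrite -piB pi_sum big_map e.
    by rewrite [X in _ - X](eq_bigr id) ?subrr // => y _; rewrite reprK.
  move=> _ /mapP[y /hs[T [_ simT] Ty] ->] r.
  have [/eqP ry0|ry0] := boolP (r *: y == 0).
    by left; apply/pi_eq0; rewrite -piZ reprK.
  right; case: (simT (Submodule (cyclic_submodule (r *: y)))).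
  - by move=> _ /mem_Submodule[a _ <-]; do 2!apply: rpredZ.
  - move=> h; case/eqP: ry0; apply: h; apply/mem_Submodule.
    by exists 1 => //; rewrite scale1r.
  - move=> /(_ _ Ty)/mem_Submodule[a _ ay]; exists a; apply/pi_eq0.
    by rewrite -piB -!piZ reprK ay subrr.
(* Summands in [N] are dropped: their classes are zero, and there may be no simple submodule to
   contain them. *)
exists [seq piN y | y <- s & y \notin N]; split; last first.
  rewrite big_map big_filter; transitivity (\sum_(y <- s) piN y).
    apply/eqP; rewrite -subr_eq0 -pi_sum; apply/eqP.
    by rewrite piB; apply/pi_eq0.
  by rewrite (bigID (fun y => y \in N)) /= big1 ?add0r // => y /pi_eq0.
move=> _ /mapP[y + ->]; rewrite mem_filter => /andP[yN /hs ay].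
have yC : piN y \in Submodule (cyclic_submodule (piN y)).
  by apply/mem_Submodule; exists 1 => //; rewrite scale1r.
exists (Submodule (cyclic_submodule (piN y))) => //; split.
  by exists (piN y) => //; apply: contra yN => /eqP/pi_eq0.
move=> T TS; have [|nT] := pselect (forall z, z \in T -> z = 0); first by left.
right=> _ /mem_Submodule[b _ <-]; apply: rpredZ.
move/existsNP: nT => [z /not_implyP[zT z0]].
have /mem_Submodule[r _ rz] := TS _ zT.
case: (ay r) => [/pi_eq0 ry|[r' ry]]; first by case: z0; rewrite -rz piZ.
suff -> : piN y = r' *: z by exact: rpredZ.
apply/esym/eqP; rewrite -subr_eq0 -rz [r *: _]piZ [r' *: _]piZ piB.
by apply/eqP; apply/pi_eq0.
Qed.
End Quotient.

(** * The Loewy chain, built without ordinals *)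

Section LoewyTower.
Local Open Scope classical_set_scope.
Local Open Scope ring_scope.
Variables (R : pzRingType) (M : lmodType R).

(* The terms of the Loewy chain of [M], gathered without ordinals: each one is
   the union of the successors of some family of earlier ones. *)
Inductive loewy_tower : set M -> Prop :=
  LoewyTower (F : set (set M)) of (forall T, F T -> loewy_tower T) :
    loewy_tower ([set 0] `|` \bigcup_(T in F) socle_mod T).

Lemma loewy_tower0 S : loewy_tower S -> S 0.
Proof. by case=> F _; left. Qed.

(** Induction on [S]. If [T] lies in a member [A] of the family of [S], then [socle_mod T] lies in
    [socle_mod A], hence in [S]. Otherwise [T] escapes each [A] through some [socle_mod B], with [B]
    in the family of [T]; the induction hypothesis then puts [A] inside [B], so [socle_mod A] lies
    in [T]. *)
Lemma loewy_tower_cmp S T : loewy_tower S -> loewy_tower T ->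
  S `<=` T \/ socle_mod T `<=` S.
Proof.
move=> hS; elim: hS T => {S} F hF IH T hT.
have [[A FA TA]|nex] := pselect (exists2 A, F A & T `<=` A).
  by right=> x Tx; right; exists A => //; exact: socle_mod_mono Tx.
left=> x [->|[A FA Ax]]; first exact: loewy_tower0.
have /existsNP[t /not_implyP[Tt nAt]] : ~ T `<=` A by move=> TA; apply: nex; exists A.
case: hT {nex} Tt => G hG [t0|[B GB Bt]].
  by case: nAt; rewrite t0; apply: loewy_tower0; exact: hF.
case: (IH _ FA _ (hG _ GB)) => [AB|/(_ _ Bt)//].
by right; exists B => //; exact: socle_mod_mono Ax.
Qed.

Lemma loewy_tower_submodule S : loewy_tower S -> is_submodule S.
Proof.
elim=> {}S hS IH; split=> [|a x y]; first by left.
have sub A : S A -> is_submodule (socle_mod A) by move/IH/socle_mod_submodule.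
have cmp A B : S A -> S B -> exists2 C, S C & socle_mod A `|` socle_mod B `<=` socle_mod C.
  move=> SA SB; case: (loewy_tower_cmp (hS _ SA) (hS _ SB)) => [AB|BA].
    by exists B => // z [|//]; exact: socle_mod_mono.
  by exists A => // z [//|/BA]; exact: sub_socle_mod.
move=> [->|[A SA Ax]] [->|[B SB By]].
- by left; rewrite scaler0 addr0.
- by rewrite scaler0 add0r; right; exists B.
- by rewrite addr0; right; exists A => //; apply: submoduleZ => //; exact: sub.
have [C SC ABC] := cmp _ _ SA SB; right; exists C => //.
by case: (sub _ SC) => _; apply; apply: ABC; [left|right].
Qed.

Lemma loewy_tower_succ S : loewy_tower S -> loewy_tower (socle_mod S).
Proof.
move=> hS; suff <- : [set 0] `|` \bigcup_(T in [set S]) socle_mod T = socle_mod S.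
  by constructor=> _ ->.
apply/seteqP; split=> [x [->|[_ -> //]]|x Sx]; last by right; exists S.
by have [] := socle_mod_submodule (loewy_tower_submodule hS).
Qed.

Lemma loewy_tower_total S T : loewy_tower S -> loewy_tower T -> S `<=` T \/ T `<=` S.
Proof.
move=> hS hT; case: (loewy_tower_cmp hS hT) => [|h]; [by left|right].
by apply: subset_trans h; exact: sub_socle_mod.
Qed.

Lemma loewy_tower_fix S T : loewy_tower S -> loewy_tower T ->
  socle_mod S `<=` S -> T `<=` S.
Proof.
move=> hS hT SS; elim: hT => {T} F _ IH x [->|[T FT Tx]]; first exact: loewy_tower0.
exact/SS/(socle_mod_mono (IH _ FT)).
Qed.

(** This serves the limit clause of the Loewy chain. The family of [S] may contain [S] itself; the
    induction hypothesis for that member then gives a smaller one. *)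
Lemma loewy_tower_proper S x : loewy_tower S -> S x -> x = 0 \/
  exists2 T, loewy_tower T & [/\ T `<=` S, ~ S `<=` T & socle_mod T x].
Proof.
elim=> {S}S hS IH; set U := _ `|` _ => -[->|[T ST Tx]]; first by left.
have TU : T `<=` U.
  by move=> z Tz; right; exists T => //; exact: sub_socle_mod Tz.
have [UT|UT] := pselect (U `<=` T); last by right; exists T => //; exact: hS.
have eUT : U = T by apply/seteqP.
by rewrite eUT; apply: (IH T ST); apply: UT; right; exists T.
Qed.

(** Ordered by inclusion, the terms themselves form the well-ordered type that indexes the chain. *)
Definition loewy_term : Type := {S : set M | `[< loewy_tower S >]}.
HB.instance Definition _ := Choice.on loewy_term.

Implicit Types S T : loewy_term.

Definition loewy_set S : set M := val S.
Lemma loewy_setP S : loewy_tower (loewy_set S). Proof. exact/asboolP/(valP S). Qed.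
Definition LoewyTerm (S : set M) (hS : loewy_tower S) : loewy_term :=
  exist _ S (asboolT hS).

Definition loewy_le S T : bool := `[< loewy_set S `<=` loewy_set T >].

Fact loewy_le_refl : reflexive loewy_le.
Proof. by move=> S; apply/asboolP. Qed.
Fact loewy_le_anti : antisymmetric loewy_le.
Proof. by move=> S T /andP[/asboolP ST /asboolP TS]; apply/val_inj/seteqP. Qed.
Fact loewy_le_trans : transitive loewy_le.
Proof.
by move=> S T U /asboolP ST /asboolP TU; apply/asboolP; exact: subset_trans TU.
Qed.
HB.instance Definition _ := Order.Le_isPOrder.Build (Order.Disp tt tt) loewy_term
  loewy_le_refl loewy_le_anti loewy_le_trans.

Fact loewy_le_total : total loewy_le.
Proof.
move=> S T; apply/orP.
by case: (loewy_tower_total (loewy_setP S) (loewy_setP T)) => h; [left|right]; apply/asboolP.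
Qed.
HB.instance Definition _ := Order.POrder_isTotal.Build (Order.Disp tt tt) loewy_term
  loewy_le_total.

Fact loewy_bot_subproof : loewy_tower [set 0].
Proof.
have {1}-> : [set 0] = [set 0] `|` \bigcup_(T in set0) @socle_mod R M T.
  by rewrite bigcup_set0 setU0.
by constructor.
Qed.
Definition loewy_bot : loewy_term := LoewyTerm loewy_bot_subproof.
Fact loewy_le0 S : (loewy_bot <= S)%O.
Proof. by apply/asboolP => _ ->; exact: (loewy_tower0 (loewy_setP _)). Qed.
HB.instance Definition _ := Order.hasBottom.Build (Order.Disp tt tt) loewy_term
  loewy_le0.

Lemma loewy_leP S T : (S <= T)%O <-> loewy_set S `<=` loewy_set T.
Proof. by split=> /asboolP. Qed.

Lemma loewy_ltP S T : (S < T)%O <-> ~ loewy_set T `<=` loewy_set S.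
Proof. by rewrite ltNge; split=> [/negP h /asboolP //|h]; apply/negP => /asboolP. Qed.

(** A term strictly below [T] misses a point of some [socle_mod V], with [V] in the family of [T];
    by comparison it is at most [V], which is accessible by induction. *)
Lemma loewy_wf : well_founded (fun S T : loewy_term => (S < T)%O).
Proof.
suff acc (S : set M) : loewy_tower S -> forall T, loewy_set T = S ->
    Acc (fun S T : loewy_term => (S < T)%O) T.
  by move=> S; exact: (acc _ (loewy_setP S)).
elim=> {}S hS IH T eT; constructor=> U /loewy_ltP; rewrite eT => /existsNP.
move=> [x /not_implyP[[->|[V SV Vx]]]] nUx.
  by case: nUx; exact: (loewy_tower0 (loewy_setP _)).
have aV := IH V SV (LoewyTerm (hS _ SV)) erefl.
have : (U <= LoewyTerm (hS _ SV))%O.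
  by apply/loewy_leP; case: (loewy_tower_cmp (loewy_setP U) (hS _ SV)) => // /(_ _ Vx).
by rewrite le_eqVlt => /orP[/eqP -> //|]; exact: (Acc_inv aV).
Qed.

Definition loewy_submod S : submodClosed M :=
  Submodule (loewy_tower_submodule (loewy_setP S)).

Lemma mem_loewy_submod S x : (x \in loewy_submod S) <-> loewy_set S x.
Proof. exact: mem_Submodule. Qed.

Lemma socle_loewy S x :
  socle (\pi_(quotmod (loewy_submod S))%qT x) <-> socle_mod (loewy_set S) x.
Proof.
have -> : loewy_set S = [set x | x \in loewy_submod S].
  by apply/funext => y; apply/propext; split=> /mem_loewy_submod.
exact: socle_quotmod.
Qed.

Lemma loewy_chain_tower : loewy_chain loewy_submod.
Proof.
split=> [x|S T ST Tmax x|T T0 Tlim x].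
- split=> [/mem_loewy_submod //|->]; apply/mem_loewy_submod.
  exact: (loewy_tower0 (loewy_setP _)).
(* The successor of [S] is [socle_mod S]: comparison places it below [T], and if it were strictly
   below, it would be at most [S], making [S] a fixed point that contains [T]. *)
- pose S' := LoewyTerm (loewy_tower_succ (loewy_setP S)).
  suff -> : T = S'.
    by split=> [/mem_loewy_submod h|/socle_loewy h]; [apply/socle_loewy|apply/mem_loewy_submod].
  have nTS : ~ loewy_set T `<=` loewy_set S by exact/loewy_ltP.
  have : (S' <= T)%O.
    by apply/loewy_leP; case: (loewy_tower_cmp (loewy_setP T) (loewy_setP S)).
  rewrite le_eqVlt => /orP[/eqP -> //|/Tmax/loewy_leP S'S]; case: nTS.
  exact: loewy_tower_fix (loewy_setP S) (loewy_setP T) S'S.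
split=> [/mem_loewy_submod Tx|[S /ltW /loewy_leP ST /mem_loewy_submod Sx]]; last first.
  exact/mem_loewy_submod/ST.
have [->|[S hS [ST nTS Sx]]] := loewy_tower_proper (loewy_setP T) Tx.
  by exists \bot%O; [rewrite lt0x|apply/mem_loewy_submod; exact: (loewy_tower0 (loewy_setP _))].
have [|U SU UT] := Tlim (LoewyTerm hS); first exact/loewy_ltP.
exists U => //; apply/mem_loewy_submod; move/loewy_ltP: SU => SU.
by case: (loewy_tower_cmp (loewy_setP U) hS) => [//|]; apply.
Qed.

Lemma semiartinian_moduleI :
    (forall S : set M, is_submodule S -> (exists x, ~ S x) ->
       exists2 x, atomic_mod S x & ~ S x) ->
  semiartinian_module M.
Proof.
move=> h; exists _, loewy_term, loewy_submod; split.
- exact: loewy_wf.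
- exact: loewy_chain_tower.
(* With all terms as the family one gets the largest term. It belongs to its own family, so it
   absorbs every element atomic modulo it. *)
have hU : loewy_tower ([set 0] `|` \bigcup_(T in loewy_tower) @socle_mod R M T).
  by constructor.
exists (LoewyTerm hU) => x; apply/mem_loewy_submod; apply: contrapT => nx.
have [|y ay ny] := h _ (loewy_tower_submodule hU); first by exists x.
apply: ny; right; exists (loewy_set (LoewyTerm hU)) => //.
exists [:: y]; first by move=> z; rewrite inE => /eqP ->.
by rewrite big_seq1 subrr; exact: (loewy_tower0 hU).
Qed.

(** At the least index [a] with [L a] not inside [T], the limit case is impossible. In the successor
    case an element of [L a] is a sum of elements atomic modulo an earlier term, hence modulo [T],
    and one summand is outside [T]. *)
Lemma semiartinian_moduleE (T : set M) : semiartinian_module M ->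
  is_submodule T -> (exists x, ~ T x) -> exists2 x, atomic_mod T x & ~ T x.
Proof.
move=> [d [W [L [wfW [L0 Ls Ll] [top Ltop]]]]] hT [x0 nx0].
pose bad a := exists2 x, x \in L a & ~ T x.
have btop : bad top by exists x0.
have {btop} [a [bad_a a_min]] : exists a, bad a /\ forall b, (b < a)%O -> ~ bad b.
  elim/(well_founded_ind wfW): top btop {Ltop} => a IH ba.
  have [[b ba' bb]|nb] := pselect (exists2 b, (b < a)%O & bad b); first exact: IH bb.
  by exists a; split=> // b ba' bb; apply: nb; exists b.
have LT b : (b < a)%O -> [set x | x \in L b] `<=` T.
  by move=> /a_min nb x Lx; apply: contrapT => nx; apply: nb; exists x.
have a0 : a != \bot%O.
  apply: contraTneq isT => ea; case: bad_a => x; rewrite ea => /L0 ->.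
  by case; case: hT.
case: bad_a => x Lx nTx.
have [[b [ba bmax]]|nb] := pselect (exists b, (b < a)%O /\ forall c, (c < a)%O -> (c <= b)%O).
  have /socle_quotmod[s hs xs] := (Ls _ _ ba bmax x).1 Lx.
  have [h|/existsNP[y /not_implyP[ys nTy]]] := pselect (forall y, y \in s -> T y).
    case: nTx; rewrite -(subrK (\sum_(y <- s) y) x); apply: submoduleD => //.
      exact: LT xs.
    exact: submodule_sum.
  exists y => // r; case: (hs _ ys r) => [/(LT _ ba)|[r' /(LT _ ba)]]; first by left.
  by right; exists r'.
have alim b : (b < a)%O -> exists2 c, (b < c)%O & (c < a)%O.
  move=> ba; apply: contrapT => nc; apply: nb; exists b; split=> // c ca.
  by rewrite leNgt; apply/negP => bc; apply: nc; exists c.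
by have [b ba Lb] := (Ll a a0 alim x).1 Lx; case: nTx; exact: LT Lb.
Qed.
End LoewyTower.

(** * Right ideals, maximal right ideals and right primitive ideals *)

Section RightIdeals.
Local Open Scope classical_set_scope.
Local Open Scope ring_scope.
Variable R : pzRingType.
Implicit Types (a b f r x y : R) (S m : set R).

Definition right_ideal S : Prop := @is_submodule R^c (R^c)^o S.

Lemma right_idealP S :
  S 0 -> (forall x y, S x -> S y -> S (x + y)) -> (forall x a, S x -> S (x * a)) ->
  right_ideal S.
Proof. by move=> S0 SD SM; split=> // a x y Sx Sy; apply: SD => //; exact: SM. Qed.

Lemma right_ideal0 S : right_ideal S -> S 0. Proof. by case. Qed.

Lemma right_idealD S x y : right_ideal S -> S x -> S y -> S (x + y).
Proof. exact: (@submoduleD R^c (R^c)^o). Qed.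

Lemma right_idealB S x y : right_ideal S -> S x -> S y -> S (x - y).
Proof. exact: (@submoduleB R^c (R^c)^o). Qed.

Lemma right_idealM S x a : right_ideal S -> S x -> S (x * a).
Proof. exact: (@submoduleZ R^c (R^c)^o S a x). Qed.

Lemma right_ideal_sum S (T : eqType) (s : seq T) (F : T -> R) : right_ideal S ->
  (forall t, t \in s -> S (F t)) -> S (\sum_(t <- s) F t).
Proof. exact: (@submodule_sum R^c (R^c)^o). Qed.

Lemma right_ideal_bigcup (F : set (set R)) : F !=set0 -> total_on F subset ->
  (forall S, F S -> right_ideal S) -> right_ideal (\bigcup_(S in F) S).
Proof.
move=> [S0 FS0] Ftot Fideal; apply: right_idealP => [|x y [S FS Sx] [T FT Ty]|x a [S FS Sx]].
- by exists S0 => //; apply: right_ideal0; exact: Fideal.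
- case: (Ftot _ _ FS FT) => h; [exists T|exists S] => //.
    by apply: right_idealD => //; [exact: Fideal|exact: h].
  by apply: right_idealD => //; [exact: Fideal|exact: h].
- by exists S => //; apply: right_idealM => //; exact: Fideal.
Qed.

(** The last clause is maximality in terms of elements: [m] and any [b] outside it generate the
    ring. *)
Definition maximal_right_ideal m : Prop :=
  [/\ right_ideal m, ~ m 1 & forall b, ~ m b -> exists f, m (b * f - 1)].

Lemma ex_maximal_right_ideal S : right_ideal S -> ~ S 1 ->
  exists2 m, maximal_right_ideal m & S `<=` m.
Proof.
(* Zorn is applied to sets that become proper right ideals after adjoining [S]; in this way the
   empty chain, with empty union, also has an upper bound. *)
move=> hS S1; pose good (A : set R) := right_ideal (A `|` S) /\ ~ (A `|` S) 1.
have [F Fgood Ftot|A [[hA A1] Amax]] := @Zorn_bigcup R good.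
  have [F0|F0] := pselect (F !=set0); last first.
    have -> : F = set0 by apply/seteqP; split=> // A FA; case: F0; exists A.
    by rewrite /good bigcup_set0 set0U.
  rewrite /good; have -> : \bigcup_(A in F) A `|` S = \bigcup_(T in [set A `|` S | A in F]) T.
    apply/seteqP; split=> [x [[A FA Ax]|Sx]|x [_ [A FA <-] [Ax|Sx]]].
    - by exists (A `|` S); [exists A|left].
    - by case: F0 => A FA; exists (A `|` S); [exists A|right].
    - by left; exists A.
    - by right.
  split; last by case=> _ [A FA <-]; case: (Fgood _ FA).
  apply: right_ideal_bigcup.
  - by case: F0 => A FA; exists (A `|` S), A.
  - move=> _ _ [A FA <-] [B FB <-].
    by case: (Ftot _ _ FA FB) => h; [left|right]; exact: setSU.
  - by move=> _ [A FA <-]; case: (Fgood _ FA).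
exists (A `|` S); last by move=> x; right.
split=> // b nAb; pose B := [set x | exists y f, (A `|` S) y /\ x = y + b * f].
have AB : A `|` S `<=` B by move=> x Ax; exists x, 0; rewrite mulr0 addr0.
have hB : right_ideal B.
  apply: right_idealP => [|x y|x a].
  - by apply: AB; exact: right_ideal0.
  - move=> [u [f [Au ->]]] [v [g [Av ->]]]; exists (u + v), (f + g).
    by rewrite mulrDr addrACA; split=> //; exact: right_idealD.
  - move=> [u [f [Au ->]]]; exists (u * a), (f * a).
    by rewrite mulrDl mulrA; split=> //; exact: right_idealM.
have Bb : B b by exists 0, 1; rewrite mulr1 add0r; split=> //; exact: right_ideal0.
have BS : B `|` S = B by apply/seteqP; split=> [x [//|Sx]|x]; [apply: AB; right|left].
have [y [f [Ay e]]] : B 1.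
  apply: contrapT => B1; apply: (Amax B); last by rewrite /good BS.
  split=> [x Ax|BA]; first by apply: AB; left.
  by apply: nAb; left; exact: BA.
exists f; suff -> : b * f - 1 = 0 - y.
  by apply: right_idealB => //; exact: right_ideal0.
by rewrite e sub0r opprD addrCA subrr addr0.
Qed.

(** The set is the annihilator of the quotient by [m], which is simple because every nonzero class
    generates the class of 1. *)
Lemma maximal_right_ideal_primitive m : maximal_right_ideal m ->
  right_primitive [set a | forall r, m (r * a)].
Proof.
move=> [hm m1 mmax]; pose N := @Submodule R^c (R^c)^o m hm.
have NP x : (x \in N) <-> m x by exact: (@mem_Submodule R^c (R^c)^o).
have piM (a x : R) : (a : R^c) *: (\pi_(quotmod N)%qT (x : (R^c)^o) : quotmod N) =
    \pi_(quotmod N)%qT (x * a : R) by exact: (@piZ R^c (R^c)^o).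
exists (quotmod N).
  split; first by exists (\pi_(quotmod N)%qT (1 : R)); apply/eqP => /pi_eq0/NP.
  move=> T; have [|/existsNP[z /not_implyP[Tz z0]]] := pselect (forall u, u \in T -> u = 0).
    by left.
  right=> u; rewrite -[z]reprK in Tz z0; rewrite -[u]reprK.
  have [|f mf] := mmax (repr z); first by move/NP/pi_eq0.
  have T1 : \pi_(quotmod N)%qT (1 : R) \in T.
    suff <- : (f : R^c) *: (\pi_(quotmod N)%qT (repr z : (R^c)^o) : quotmod N)
      = \pi_(quotmod N)%qT (1 : R) by exact: rpredZ.
    rewrite piM; apply/eqP; rewrite -subr_eq0 piB; apply/eqP.
    by apply/pi_eq0/NP.
  by rewrite -[repr u](@mul1r R) -piM; apply: rpredZ.
apply/seteqP; split=> a ha; last first.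
  by move=> r; apply/NP/pi_eq0; rewrite -piM; exact: ha.
move=> z; rewrite -[z]reprK; apply: etrans (piM _ _) _.
exact/pi_eq0/NP.
Qed.

Lemma right_primitive_ideal m : right_primitive m ->
  [/\ right_ideal m, forall a b, m b -> m (a * b), ~ m 1 &
      forall a b, ~ m a -> ~ m b -> exists r, ~ m (a * r * b)].
Proof.
move=> [M simM ->].
(* Scaling by [R^c] is the right action, so [a] acts first. *)
have actM (a b : R) (u : M) : ((a * b : R) : R^c) *: u = (b : R^c) *: ((a : R^c) *: u).
  by apply/esym; exact: (@scalerA R^c M b a u).
split.
- apply: right_idealP => [u|x y hx hy u|x a hx u]; first exact: scale0r.
    by apply: etrans (scalerDl u (x : R^c) y) _; rewrite hx hy addr0.
  by rewrite actM hx scaler0.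
- by move=> a b hb u; rewrite actM hb.
- case: simM => -[u u0] _ /(_ u) h; case/eqP: u0.
  by apply: etrans (esym (scale1r u)) _; exact: h.
(* By simplicity some [r] moves the nonzero vector [u a] to a vector [v] that [b] does not kill. *)
move=> a b /existsNP[u au] /existsNP[v bv].
have [r er] := simple_module_gen v simM (introN eqP au).
by exists r => /(_ u); rewrite !actM -er.
Qed.

Lemma semiartinianI :
    (forall S, right_ideal S -> ~ S 1 ->
       exists2 x, (forall r, S (x * r) \/ exists r', S (x * r * r' - x)) & ~ S x) ->
  semiartinian R.
Proof.
move=> h; apply: semiartinian_moduleI => S hS [x0 nx0]; apply: h => // S1.
by apply: nx0; rewrite -[x0](@mul1r R); exact: (right_idealM _ hS).
Qed.

Lemma semiartinianE S : semiartinian R -> right_ideal S -> ~ S 1 ->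
  exists2 x, (forall r, S (x * r) \/ exists r', S (x * r * r' - x)) & ~ S x.
Proof.
by move=> hR hS S1; apply: (@semiartinian_moduleE R^c (R^c)^o) => //; exists 1.
Qed.
End RightIdeals.

(** * Generic rows and the kernel description of H(P,{i not <=}) *)

Section GenericRows.
Local Open Scope classical_set_scope.
Local Open Scope ring_scope.
Variables (dN : Order.disp_t) (N : bOrderType dN) (N_inf : infinite_set [set: N]).
Variables (K : fieldType) (d : Order.disp_t) (P : porderType d).
Local Notation X := (Defs.index N P).
Local Notation Xup i := (Defs.index N (up i)).
Local Notation Q := (cfm X K).
Local Notation glue := Defs.glue.
Implicit Types (i j k : P) (a b : Q) (x y z : X) (B : seq (P * N)).

Lemma maximal_chain_ext (C : set P) : total_on C <=%O ->
  exists2 A, maximal_chains P A & C `<=` A.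
Proof.
move=> Ctot; have [F Ftot Fchain|A [Atot Amax]] :=
    @Zorn_bigcup P (fun A => total_on (C `|` A) <=%O).
  move=> u v [Cu|[S FS Su]] [Cv|[T FT Tv]]; first exact: Ctot.
  - by apply: (Ftot _ FT); [left|right].
  - by apply: (Ftot _ FS); [right|left].
  by case: (Fchain _ _ FS FT) => h; [apply: (Ftot _ FT)|apply: (Ftot _ FS)];
    right=> //; exact: h.
exists (C `|` A) => [|u]; last by left.
split=> // B Btot CAB; apply: contrapT => nBA; apply: (Amax B).
  split=> [u Au|BA]; first by apply: CAB; right.
  by apply: nBA; apply/seteqP; split=> // u /BA; right.
have -> // : C `|` B = B.
by apply/seteqP; split=> u; [case=> // Cu; apply: CAB; left|right].
Qed.

Lemma ex_generic (A : set P) B : maximal_chains P A ->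
  exists2 x, idx_chain x = A & forall j v, (j, v) \in B -> idx_map x j != v.
Proof.
(* As [N] is infinite, one value [v] violates no constraint; it is used at the finitely many
   constrained places, and [\bot] elsewhere keeps the support finite. *)
move=> hA; have [v vB] : exists v, v \notin [seq u.2 | u <- B].
  apply: contrapT => nv; apply: N_inf.
  apply: sub_finite_set (finite_seq [seq u.2 | u <- B]) => v _ /=.
  by apply: contrapT => /negP h; apply: nv; exists v.
pose p j := if j \in [seq u.1 | u <- B] then v else \bot%O.
have hp : fin_supp p.
  apply: sub_finite_set (finite_seq [seq u.1 | u <- B]) => j /=; rewrite /p.
  by case: ifP => // _; rewrite eqxx.
exists (Index hp hA) => // j w jw; have -> : idx_map (Index hp hA) j = p j by [].
rewrite /p (map_f fst jw); apply: contraNneq vB => ->.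
exact: (map_f snd jw).
Qed.

(** [B] lists forbidden values at given places. Constraints at places above [i] are ignored, which
    makes genericity invariant under [agree i]. *)
Definition generic i B x : Prop := idx_chain x i /\
  forall j v, (j, v) \in B -> ~~ (i <= j)%O -> idx_map x j != v.

Lemma generic_agree i B x y : agree i x y -> generic i B x -> generic i B y.
Proof.
move=> [[xi yi] _ h] [_ gx]; split=> // j v jv ij.
by rewrite -(h _ ij); exact: gx.
Qed.

Lemma generic_cat i B B' x : generic i (B ++ B') x -> generic i B x /\ generic i B' x.
Proof.
by move=> [xi g]; split; split=> // j v jv; apply: g; rewrite mem_cat jv ?orbT.
Qed.

(* Two matrices agree on almost every row whose chain contains [i]. Summands in
   [H(P,j)] with [j] not above [i] vanish on such rows, those with [j] above [i]
   are block diagonal along [agree i]. *)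
Definition eqg i a b : Prop := exists B, forall x, generic i B x -> forall y, a x y = b x y.

Lemma eqg_refl i a : eqg i a a. Proof. by exists [::]. Qed.

Lemma eqg_sym i a b : eqg i a b -> eqg i b a.
Proof. by move=> [B h]; exists B => x gx y; rewrite (h _ gx). Qed.

Lemma eqg_trans i b a c : eqg i a b -> eqg i b c -> eqg i a c.
Proof.
move=> [B h] [B' h']; exists (B ++ B') => x /generic_cat[gx gx'] y.
by rewrite (h _ gx) (h' _ gx').
Qed.

Lemma cfmDE (Y : choiceType) (a b : cfm Y K) (x y : Y) : cfm_fun (a + b) x y = a x y + b x y.
Proof. by []. Qed.

Lemma eqgD i a b a' b' : eqg i a a' -> eqg i b b' -> eqg i (a + b) (a' + b').
Proof.
move=> [B h] [B' h']; exists (B ++ B') => x /generic_cat[gx gx'] y.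
by rewrite !cfmDE (h _ gx) (h' _ gx').
Qed.

Lemma eqgN i a b : eqg i a b -> eqg i (- a) (- b).
Proof. by move=> [B h]; exists B => x gx y; congr (- _); exact: h. Qed.

Lemma psi0 i : psi (0 : cfm (Xup i) K) = 0 :> Q.
Proof. by rewrite -(scale0r (0 : cfm (Xup i) K)) -psi_scale scale0r. Qed.

Lemma psiD i (c e : cfm (Xup i) K) : psi (c + e) = psi c + psi e :> Q.
Proof.
apply: cfmP => x y; rewrite cfmDE; have [xy|nxy] := pselect (agree i x y).
  by rewrite !(psi_agree _ (agree_l xy) (agree_r xy)).
by rewrite -[LHS]/(psi_fun _ _ _) -[psi c x y]/(psi_fun _ _ _)
  -[psi e x y]/(psi_fun _ _ _) !psi_fun_nagree ?addr0.
Qed.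

Lemma psiM i (c e : cfm (Xup i) K) : psi (c * e) = psi c * psi e :> Q.
Proof.
apply: cfmP => x z; have [xz|nxz] := pselect (agree i x z); last first.
  rewrite -[LHS]/(psi_fun _ _ _) psi_fun_nagree //; apply/esym/eqP.
  apply: contrapT => /negP/cfm_mul_neq0[y [/psi_neq0 xy /psi_neq0 yz]].
  exact: nxz (agree_trans xy yz).
rewrite (psi_agree _ (agree_l xz) (agree_r xz)) //.
apply/esym; apply: etrans (sum_glue (agree_l xz) (f := fun y => psi c x y * psi e y z) _) _.
  by move=> y; rewrite mulf_eq0 negb_or => /andP[/psi_neq0/agree_sym].
apply: eq_fsbigr => s _; pose y := glue s (agree_l xz).
have yx : agree i y x by exact: agree_glue.
have xy := agree_sym yx; have yz := agree_trans yx xz.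
rewrite -[LHS]/(psi c x y * psi e y z).
by rewrite (psi_agree _ (agree_l xz) (glue_i _ _)) //
  (psi_agree _ (glue_i _ _) (agree_r xz)) // restr_glue.
Qed.

(** A generic row of [a] is a row of [psi c], supported on indices that agree with it at [i]; these
    are again generic, so [b] may be replaced by [b'] there. *)
Lemma eqgM i a b b' (c : cfm (Xup i) K) :
  eqg i a (psi c) -> eqg i b b' -> eqg i (a * b) (psi c * b').
Proof.
move=> [B h] [B' h']; exists (B ++ B') => x /generic_cat[gx gx'] z.
apply: eq_fsbigr => y _; rewrite (h _ gx).
have [/eqP ->|/psi_neq0 xy] := boolP (psi c x y == 0); first by rewrite !mul0r.
by rewrite (h' _ (generic_agree xy gx')).
Qed.

Lemma ex_index i : exists x, idx_chain x i.
Proof.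
have [|A hA iA] := @maximal_chain_ext [set i]; first by move=> _ _ -> ->; left.
by have [x xA _] := ex_generic [::] hA; exists x; rewrite xA; exact: iA.
Qed.

(** On rows through [i], [psi c] is block diagonal along [agree i], and by [psi_glue_up] all blocks
    are equal; [e] is the block of an arbitrary [x0]. *)
Lemma eqg_down i j (c : cfm (Xup j) K) : (i <= j)%O ->
  exists e : cfm (Xup i) K, eqg i (psi c) (psi e).
Proof.
move=> ij; have [x0 xi0] := ex_index i.
have fe : column_finite (fun s t => psi c (glue s xi0) (glue t xi0)).
  move=> t.
  apply: (finite_preimage (f := fun s => glue s xi0)
    (B := [set x | psi c x (glue t xi0) != 0])); last exact: cfm_finite.
  by move=> s s' _ _; exact: glue_inj.
exists (Cfm fe), [::] => x [xi _] y; have [xy|nxy] := pselect (agree i x y).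
  rewrite [RHS](psi_agree _ xi (agree_r xy)) // -[RHS]/(psi c (glue _ xi0) (glue _ xi0)).
  rewrite (psi_glue_up c ij _ _ xi0 xi) !glue_restr //.
  exact: agree_sym.
rewrite -[RHS]/(psi_fun _ _ _) psi_fun_nagree //; apply/eqP; apply: contrapT => /negP.
by move=> /psi_neq0 xy; apply: nxy; exact: agree_down xy.
Qed.

Lemma HiD i a b : Hi i a -> Hi i b -> Hi i (a + b).
Proof.
rewrite /Hi; case: asboolP => mi.
  by move=> [k _ <-] [l _ <-]; exists (k + l) => //; rewrite scalerDl.
move=> [c fc <-] [e fe <-]; exists (c + e); last exact: psiD.
apply: (@sub_finite_set _ _ ([set s | exists t, c s t != 0] `|` [set s | exists t, e s t != 0])).
  move=> s [t]; rewrite cfmDE => nz; have [c0|c0] := boolP (c s t == 0).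
    by right; exists t; move: nz; rewrite (eqP c0) add0r.
  by left; exists t.
by rewrite finite_setU.
Qed.

Lemma Hi0 i : Hi i (0 : Q).
Proof.
rewrite /Hi; case: asboolP => _; first by exists 0 => //; rewrite scale0r.
exists 0; last exact: psi0.
by apply: sub_finite_set (finite_set0 _) => s /= [t]; rewrite -[cfm_fun 0 s t]/0 eqxx.
Qed.

Lemma Hi_eqg0 i j a : ~~ (i <= j)%O -> Hi j a -> eqg i a 0.
Proof.
move=> ij aj; have [ji|ji] := boolP (j <= i)%O; last first.
  have [c ->] := Hi_psi aj; exists [::] => x [xi _] y; apply/eqP; apply: contrapT => /negP.
  move=> /psi_neq0/agree_l xj; have [xtot _] := idx_chainP x.
  by case: (xtot _ _ xi xj); apply/negP.
have [mj|[_ [c fc ->]]] := HiE aj.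
  by case: mj => mj _; rewrite (mj _ ji) lexx in ij.
pose jj : up j := exist _ j (lexx j).
pose S := fset_set [set s | exists t, c s t != 0].
(* Here [j] lies below [i] and is not maximal, so [c] has finitely many nonzero rows; forbidding
   their values at [j] makes the row of [psi c] vanish. *)
exists [seq (j, idx_map s jj) | s <- S] => x [xi gx] y.
apply/eqP; apply: contrapT => /negP nz; have xy := psi_neq0 nz.
rewrite (psi_agree _ (agree_l xy) (agree_r xy)) // in nz.
have /negP : idx_map x j != idx_map (restr (agree_l xy)) jj.
  apply: gx ij; apply: (map_f (fun s => (j, idx_map s jj))).
  by rewrite in_fset_set // inE; exists (restr (agree_r xy)).
by apply; apply/eqP.
Qed.

Lemma eqg_psi i b : HJ setT b -> exists2 c : cfm (Xup i) K,
  eqg i b (psi c) & maximal_element i -> exists l : K, c = l *: (1 : cfm (Xup i) K).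
Proof.
move=> [s [hs ->]]; elim: s hs => [|a s IH] hs.
  rewrite big_nil; exists 0; first by rewrite psi0; exact: eqg_refl.
  by exists 0; rewrite scale0r.
have [|c bc cmax] := IH; first by move=> b' bs; apply: hs; rewrite inE bs orbT.
have [j _ ja] : exists2 j, [set: P] j & Hi j a by apply: hs; rewrite inE eqxx.
suff [e ae emax] : exists2 e : cfm (Xup i) K,
    eqg i a (psi e) & maximal_element i -> exists l : K, e = l *: (1 : cfm (Xup i) K).
  exists (e + c); first by rewrite big_cons psiD; exact: eqgD.
  by move=> mi; case: (emax mi) (cmax mi) => l -> [m ->]; exists (l + m); rewrite scalerDl.
have [ij|ij] := boolP (i <= j)%O; last first.
  exists 0; first by rewrite psi0; exact: Hi_eqg0 ja.
  by exists 0; rewrite scale0r.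
have [mi|mi] := pselect (maximal_element i).
  rewrite (mi _ ij) in ja; case: (HiE ja) => -[// _ [l ->]].
  by exists (l *: (1 : cfm (Xup i) K)); [rewrite psi_scale; exact: eqg_refl|exists l].
have [c' ->] := Hi_psi ja; have [e ee] := eqg_down c' ij.
by exists e.
Qed.

(** A chain through [i] and [k] carries a row satisfying both lists of constraints. Gluing any [s]
    above [k] preserves this, since a place not above [i] is not above [k]. So every entry of [c] is
    an entry of [b] in a row where [b] vanishes. *)
Lemma eqg_up i k b (c : cfm (Xup k) K) : (i <= k)%O ->
  eqg i b 0 -> eqg k b (psi c) -> c = 0.
Proof.
move=> ik [B h] [B' h'].
have [|A hA iA] := @maximal_chain_ext [set j | j = i \/ j = k].
  by move=> u v [->|->] [->|->]; [left|left|right|left].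
have [x xA gx] := ex_generic (B ++ B') hA.
have xi : idx_chain x i by rewrite xA; apply: iA; left.
have xk : idx_chain x k by rewrite xA; apply: iA; right.
apply: cfmP => s t; rewrite -[RHS]/(0 : K).
have sx := agree_glue s xk; have tx := agree_glue t xk.
have g' : generic k B' (glue s xk).
  apply: generic_agree (agree_sym sx) _; split=> // j v jv _.
  by apply: gx; rewrite mem_cat jv orbT.
have g : generic i B (glue s xk).
  split=> [|j v jv ij]; first by left.
  have kj : ~~ (k <= j)%O by apply: contra ij; exact: le_trans.
  by case: sx => _ _ -> //; apply: gx; rewrite mem_cat jv.
rewrite -[LHS](_ : psi c (glue s xk) (glue t xk) = _); last first.
  by rewrite (psi_agree _ (glue_i _ _) (glue_i _ _)) ?restr_glue //;
    exact: agree_trans sx (agree_sym tx).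
by rewrite -(h' _ g') (h _ g).
Qed.

Lemma eqg_psi_inj i (c e : cfm (Xup i) K) : eqg i (psi c) (psi e) -> c = e.
Proof.
move=> ce; apply/eqP; rewrite -subr_eq0; apply/eqP.
apply: (@eqg_up i i 0) => //; first exact: eqg_refl.
have -> : psi (c - e) = psi c - psi e :> Q.
  by rewrite psiD -!scaleN1r psi_scale.
rewrite -(subrr (psi e)); apply: eqg_sym; apply: eqgD => //.
exact: eqg_refl.
Qed.

Lemma HJ_eqg0 i b : HJ [set j | ~~ (i <= j)%O] b -> eqg i b 0.
Proof.
move=> [s [hs ->]]; elim: s hs => [|a s IH] hs; first by rewrite big_nil; exact: eqg_refl.
rewrite big_cons -[X in eqg _ _ X]addr0; apply: eqgD.
  by have [|j ij] := hs a; [rewrite inE eqxx|exact: Hi_eqg0].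
by apply: IH => b' bs; apply: hs; rewrite inE bs orbT.
Qed.

(** Summands are merged by index so that the one at a maximal index can be isolated in [eqg0_HJ]. *)
Lemma HJ_uniq (J : set P) b : HJ J b -> exists (F : seq P) (f : P -> Q),
  [/\ uniq F, forall j, j \in F -> J j, forall j, Hi j (f j) & b = \sum_(j <- F) f j].
Proof.
move=> [s [hs ->]]; elim: s hs => [|a s IH] hs.
  by exists [::], (fun=> 0); split=> //; [move=> j; exact: Hi0|rewrite !big_nil].
have [|F [f [uF FJ Hf e]]] := IH; first by move=> b' bs; apply: hs; rewrite inE bs orbT.
have [|k Jk ak] := hs a; first by rewrite inE eqxx.
have Hif j (u v : Q) : (j = k -> Hi j u) -> Hi j v -> Hi j (if j == k then u else v).
  by move=> hu hv; case: eqP => // /hu.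
have [kF|kF] := boolP (k \in F).
  exists F, (fun j => if j == k then a + f j else f j); split=> // [j|].
    by apply: Hif => // ->; exact: HiD.
  rewrite big_cons e !(big_rem k kF) /= eqxx addrA; congr (_ + _).
  rewrite big_seq [RHS]big_seq; apply: eq_bigr => j.
  by rewrite mem_rem_uniq // inE => /andP[/negPf ->].
exists (k :: F), (fun j => if j == k then a else f j); split=> [|j|j|].
- by rewrite /= kF.
- by rewrite inE => /orP[/eqP ->|/FJ].
- by apply: Hif => // ->.
rewrite !big_cons eqxx e; congr (_ + _).
rewrite big_seq [RHS]big_seq; apply: eq_bigr => j jF.
by case: eqP => // jk; case/negP: kF; rewrite -jk.
Qed.

Lemma ex_maximal_mem (F : seq P) k :
  exists m, [/\ m \in k :: F, (k <= m)%O & forall j, j \in F -> (m <= j)%O -> j = m].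
Proof.
elim: F k => [|a F IH] k; first by exists k; rewrite mem_head.
have [ka|ka] := boolP (k <= a)%O.
  have [m [mF am mmax]] := IH a; exists m; split.
  - by rewrite inE mF orbT.
  - exact: le_trans am.
  - by move=> j; rewrite inE => /orP[/eqP -> ma|/mmax //]; apply: le_anti; rewrite am.
have [m [mF km mmax]] := IH k; exists m; split=> //.
  by move: mF; rewrite !inE => /orP[->|->] //; rewrite !orbT.
move=> j; rewrite inE => /orP[/eqP -> ma|/mmax //].
by rewrite (le_trans km ma) in ka.
Qed.

(** With [HJ_eqg0], this identifies H(P,{i not <=}) with a kernel. If an index above [i] occurs,
    take a maximal one [m]: generically at [m] only its own summand survives, so that summand is
    zero by [eqg_up] and can be removed. *)
Lemma eqg0_HJ i b : HJ setT b -> eqg i b 0 -> HJ [set j | ~~ (i <= j)%O] b.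
Proof.
move=> /HJ_uniq[F [f [uF _ Hf ->]]].
have [n] := ubnP (size F); elim: n F uF => // n IH F uF /ltnSE leFn F0.
have [[k kF ik]|nk] := pselect (exists2 k, k \in F & (i <= k)%O); last first.
  apply: HJ_sum => j jF; apply: Hi_HJ (Hf j) => /=.
  by apply/negP => ij; apply: nk; exists j.
have [m [mF km mmax]] := ex_maximal_mem F k.
have {}mF : m \in F by move: mF; rewrite inE => /orP[/eqP ->|].
have [c fm] := Hi_psi (Hf m).
have eF : \sum_(j <- F) f j = f m + \sum_(j <- rem m F) f j by rewrite (big_rem m).
have mrem : eqg m (\sum_(j <- rem m F) f j) 0.
  apply: HJ_eqg0; apply: HJ_sum => j; rewrite mem_rem_uniq // inE => /andP[jm jF].
  by apply: Hi_HJ (Hf j) => /=; apply: contra jm => /(mmax _ jF) ->.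
have c0 : c = 0.
  apply: (eqg_up (le_trans ik km) F0); rewrite eF fm -[X in eqg _ _ X]addr0.
  by apply: eqgD => //; exact: eqg_refl.
have e0 : f m = 0 by rewrite fm c0 psi0.
rewrite e0 add0r in eF; rewrite eF in F0 *; apply: IH => //.
  exact: rem_uniq.
by rewrite size_rem // -ltnS prednK //; case: (F) mF.
Qed.
End GenericRows.

(** * Matrices with a single nonzero row *)

Section RowMatrices.
Local Open Scope classical_set_scope.
Local Open Scope ring_scope.
Variables (Y : choiceType) (K : fieldType).
Implicit Types (a b : cfm Y K) (v : Y -> K).

Fact row_matrix_subproof (s : Y) v : column_finite (fun x y => if x == s then v y else 0).
Proof.
apply: cfm_fset => y; exists [fset s]%fset => x.
by rewrite inE => /negPf ->.
Qed.
Definition row_matrix s v : cfm Y K := Cfm (row_matrix_subproof s v).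

Lemma row_matrixE s v x y : row_matrix s v x y = if x == s then v y else 0.
Proof. by []. Qed.

Lemma row_matrix_finite s v : finite_rows (row_matrix s v).
Proof.
apply: sub_finite_set (finite_set1 s) => x /= [y]; rewrite row_matrixE.
by have [->|_] := eqVneq x s; rewrite ?eqxx.
Qed.

Lemma mul_row_matrix a s v x y : cfm_fun (a * row_matrix s v) x y = a x s * v y.
Proof.
have h z : z \notin [fset s]%fset -> row_matrix s v z y = 0.
  by rewrite inE row_matrixE => /negPf ->.
by rewrite (cfm_mulE_fset _ _ h) big_seq_fset1 row_matrixE eqxx.
Qed.

(** The left factor is the matrix unit at [(t, s)]. *)
Lemma row_matrix_delta_mul t s b : row_matrix t (fun y => (s == y)%:R) * b = row_matrix t (b s).
Proof.
apply: cfmP => x z; rewrite row_matrixE; case: eqP => [->|xt].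
  rewrite -[b in RHS](@mul1r (cfm Y K)).
  by apply: eq_fsbigr => y _; rewrite row_matrixE eqxx.
apply/eqP; apply: contrapT => /negP/cfm_mul_neq0[y []].
by rewrite row_matrixE; case: (x =P t) => // _; rewrite eqxx.
Qed.

Lemma finite_rows_sum a : finite_rows a ->
  exists S : seq Y, a = \sum_(s <- S) row_matrix s (a s).
Proof.
move=> fa; exists (fset_set [set x | exists y, a x y != 0]); apply: cfmP => x y.
set S := fset_set _.
have -> (s : seq Y) : cfm_fun (\sum_(t <- s) row_matrix t (a t)) x y =
    \sum_(t <- s) row_matrix t (a t) x y.
  by elim: s => [|t s IH]; rewrite ?big_nil // !big_cons cfmDE IH.
have [xS|xS] := boolP (x \in S).
  rewrite (big_fsetD1 x) //= row_matrixE eqxx big_seq big1 ?addr0 // => t.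
  by rewrite !inE eq_sym row_matrixE => /andP[/negPf ->].
have -> : a x y = 0.
  apply/eqP; apply: contrapT => /negP nz; case/negP: xS.
  by rewrite in_fset_set // inE; exists y.
rewrite big_seq big1 // => t tS; rewrite row_matrixE; case: eqP => // xt.
by rewrite xt tS in xS.
Qed.

Lemma cfm_neq0 a : a <> 0 -> exists x y, a x y != 0.
Proof.
move=> a0; apply: contrapT => h; apply: a0; apply: cfmP => x y.
by apply/eqP; apply: contrapT => /negP xy; apply: h; exists x, y.
Qed.
End RowMatrices.

(** * The ideals [Psi i] and the subspaces H(P,i) inside B(P) *)

Section FrakBIdeals.
Local Open Scope classical_set_scope.
Local Open Scope ring_scope.
Variables (dN : Order.disp_t) (N : bOrderType dN) (N_inf : infinite_set [set: N]).
Variables (K : fieldType) (d : Order.disp_t) (P : porderType d) (Pcof : finite_cofinal P).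
Local Notation X := (Defs.index N P).
Local Notation Xup i := (Defs.index N (up i)).
Local Notation Q := (cfm X K).
Local Notation B := (frakB N K Pcof).
Local Notation Psi := (Psi N K Pcof).
Implicit Types (i j k : P) (a b f r : B).

Definition inH i : set B := [set b | Hi i (frakB_val b)].

Lemma HJ_sub (J J' : set P) (q : Q) : J `<=` J' -> HJ J q -> HJ J' q.
Proof. by move=> JJ' [s [hs ->]]; exists s; split=> // q' /hs[j /JJ' ? ?]; exists j. Qed.

Lemma PsiP i b : Psi i b <-> eqg i (frakB_val b) 0.
Proof.
by split=> [|h]; [exact: HJ_eqg0|apply: eqg0_HJ => //; exact: frakBP].
Qed.

Lemma frakB_eqg i b : exists2 c : cfm (Xup i) K, eqg i (frakB_val b) (psi c) &
  maximal_element i -> exists l : K, c = l *: (1 : cfm (Xup i) K).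
Proof. exact/eqg_psi/frakBP. Qed.

Lemma eqg_PsiP i b (c : cfm (Xup i) K) : eqg i (frakB_val b) (psi c) -> Psi i b <-> c = 0.
Proof.
move=> bc; rewrite PsiP; split=> [b0|c0]; last by rewrite c0 psi0 in bc.
apply: (eqg_psi_inj N_inf); rewrite psi0.
exact: eqg_trans (eqg_sym bc) b0.
Qed.

Lemma eqg_psiM i a b (c e : cfm (Xup i) K) : eqg i (frakB_val a) (psi c) ->
  eqg i (frakB_val b) (psi e) -> eqg i (frakB_val (a * b)) (psi (c * e)).
Proof. by move=> ac be; rewrite psiM; exact: eqgM. Qed.

Lemma Psi0 i : Psi i 0.
Proof. exact: HJ0. Qed.

Lemma PsiD i a b : Psi i a -> Psi i b -> Psi i (a + b).
Proof. exact: HJD. Qed.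

Lemma PsiMl i a b : Psi i b -> Psi i (a * b).
Proof.
have [c ac _] := frakB_eqg i a; have [e be _] := frakB_eqg i b.
by move=> /(eqg_PsiP be) e0; apply/(eqg_PsiP (eqg_psiM ac be)); rewrite e0 mulr0.
Qed.

Lemma PsiMr i a b : Psi i a -> Psi i (a * b).
Proof.
have [c ac _] := frakB_eqg i a; have [e be _] := frakB_eqg i b.
by move=> /(eqg_PsiP ac) c0; apply/(eqg_PsiP (eqg_psiM ac be)); rewrite c0 mul0r.
Qed.

Lemma Psi_right_ideal i : right_ideal (Psi i).
Proof.
by apply: right_idealP; [exact: Psi0|exact: PsiD|move=> a b; exact: PsiMr].
Qed.

Lemma Psi_mono i j : (i <= j)%O -> Psi i `<=` Psi j.
Proof. by move=> ij b; apply: HJ_sub => k; apply: contra; exact: le_trans. Qed.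

Lemma inH_Psi i j : ~~ (i <= j)%O -> inH j `<=` Psi i.
Proof. by move=> ij b jb; exact: Hi_HJ jb. Qed.

Lemma inH_Psi_eq0 i b : inH i b -> Psi i b -> b = 0.
Proof.
move=> /Hi_psi[c bc] /PsiP b0; apply: frakB_val_inj; rewrite frakB_val0 bc.
rewrite bc in b0; suff -> : c = 0 by exact: psi0.
by apply: (eqg_psi_inj N_inf); rewrite psi0.
Qed.

Lemma row_matrix_inH i s (v : Xup i -> K) : ~ maximal_element i ->
  exists2 b, inH i b & frakB_val b = psi (row_matrix s v).
Proof.
move=> mi; have h : Hi i (psi (row_matrix s v)).
  by rewrite /Hi asboolF //; exists (row_matrix s v) => //; exact: row_matrix_finite.
by exists (FrakB Pcof (Hi_HJ (J := setT) I h)).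
Qed.

Lemma scalar_inH i (l : K) : maximal_element i ->
  exists2 b, inH i b & frakB_val b = psi (l *: (1 : cfm (Xup i) K)).
Proof.
move=> mi; have h : Hi i (psi (l *: (1 : cfm (Xup i) K))).
  by rewrite /Hi asboolT //; exists l => //; rewrite psi_scale.
by exists (FrakB Pcof (Hi_HJ (J := setT) I h)).
Qed.

Lemma inH_neq0 i : exists2 h, inH i h & ~ Psi i h.
Proof.
have [x xi] := ex_index N_inf i; pose s := restr xi.
suff [h hi [c hc cs]] : exists2 h, inH i h &
    exists2 c : cfm (Xup i) K, frakB_val h = psi c & c s s != 0.
  exists h => // /(eqg_PsiP (c := c)) c0; move/eqP: cs; apply.
  by rewrite c0 // hc; exact: eqg_refl.
have [mi|mi] := pselect (maximal_element i).
  have [h hi e] := scalar_inH 1 mi; exists h => //; exists (1 *: (1 : cfm (Xup i) K)) => //.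
  by rewrite scale1r -[cfm_fun 1 s s]/(cfm1 _ _ _ _) cfm1E eqxx oner_neq0.
have [h hi e] := row_matrix_inH s (fun=> 1) mi.
by exists h => //; exists (row_matrix s (fun=> 1)) => //; rewrite row_matrixE eqxx oner_neq0.
Qed.

(** Modulo [Psi i], the elements are nonzero scalars if [i] is maximal; otherwise a matrix unit
    joins a nonzero entry of one to a nonzero entry of the other. *)
Lemma Psi_prime i a b : ~ Psi i a -> ~ Psi i b -> exists r, ~ Psi i (a * r * b).
Proof.
have [c ac cmax] := frakB_eqg i a; have [e be emax] := frakB_eqg i b.
move=> /(contra_not (eqg_PsiP ac).2) c0 /(contra_not (eqg_PsiP be).2) e0.
have [mi|mi] := pselect (maximal_element i).
  exists 1; rewrite mulr1 => /(eqg_PsiP (eqg_psiM ac be)).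
  have [l cl] := cmax mi; have [m em] := emax mi.
  have l0 : l != 0 by apply: contra_notN c0 => /eqP l0; rewrite cl l0 scale0r.
  have m0 : m != 0 by apply: contra_notN e0 => /eqP m0; rewrite em m0 scale0r.
  rewrite cl em scalel_cfm mul1r scalerA => /eqP.
  rewrite scaler_eq0 mulf_eq0 (negPf l0) (negPf m0) => /eqP one0.
  by apply: c0; rewrite cl one0 scaler0.
have [s [t cst]] := cfm_neq0 c0; have [s' [t' est]] := cfm_neq0 e0.
have [r _ er] := row_matrix_inH t (fun y => (s' == y)%:R) mi; exists r.
have rr : eqg i (frakB_val r) (psi (row_matrix t (fun y => (s' == y)%:R))).
  by rewrite er; exact: eqg_refl.
move=> /(eqg_PsiP (eqg_psiM (eqg_psiM ac rr) be)) /(congr1 (fun m => cfm_fun m s t')) /eqP.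
rewrite -mulrA row_matrix_delta_mul mul_row_matrix -[X in _ == X]/(0 : K).
by rewrite mulf_eq0 (negPf cst) (negPf est).
Qed.

(* The elements of [inH i] concentrated on one row generate simple right modules
   modulo [Psi i]. *)
Definition atomic i (y : B) : Prop := inH i y /\
  forall b, ~ Psi i (y * b) -> exists f, Psi i (y * b * f - y).

Lemma eqg_sub_Psi i a b (c : cfm (Xup i) K) : eqg i (frakB_val a) (psi c) ->
  eqg i (frakB_val b) (psi c) -> Psi i (a - b).
Proof.
move=> ac bc; apply/PsiP; rewrite -(subrr (psi c)).
by apply: eqgD => //; exact: eqgN.
Qed.

Lemma inH_atomic i a : inH i a ->
  exists2 s : seq B, (forall y, y \in s -> atomic i y) & a = \sum_(y <- s) y.
Proof.
move=> Ha; have [mi|mi] := pselect (maximal_element i).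
  exists [:: a]; last by rewrite big_seq1.
  move=> y; rewrite mem_seq1 => /eqP ->; split=> // b; have [e be emax] := frakB_eqg i b.
  have {emax} [m em] := emax mi; case: (HiE Ha) => -[// _ [l al]].
  have {al} ac : eqg i (frakB_val a) (psi (l *: (1 : cfm (Xup i) K))).
    by rewrite al psi_scale; exact: eqg_refl.
  have abe := eqg_psiM ac be; rewrite em scalel_cfm mul1r scalerA in abe.
  move=> /(contra_not (eqg_PsiP abe).2) lm0.
  have m0 : m != 0 by apply: contra_notN lm0 => /eqP ->; rewrite mulr0 scale0r.
  have [f _ fe] := scalar_inH m^-1 mi; exists f; apply: eqg_sub_Psi ac.
  have ff : eqg i (frakB_val f) (psi (m^-1 *: (1 : cfm (Xup i) K))).
    by rewrite fe; exact: eqg_refl.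
  by have := eqg_psiM abe ff; rewrite scalel_cfm mul1r scalerA mulfK.
case: (HiE Ha) => -[// _ [c fc ac]].
have [S cS] := finite_rows_sum fc.
have /choice[g gP] : forall s, exists b, inH i b /\ frakB_val b = psi (row_matrix s (c s)).
  by move=> s; have [b] := row_matrix_inH s (c s) mi; exists b.
exists [seq g s | s <- S]; last first.
  apply: frakB_val_inj; rewrite ac cS big_map {cS ac}.
  elim: S => [|s S IH]; first by rewrite !big_nil psi0.
  by rewrite !big_cons psiD frakB_valD (gP s).2 IH.
move=> _ /mapP[s _ ->]; have [Hg eg] := gP s; split=> // b.
have [e be _] := frakB_eqg i b.
have gg : eqg i (frakB_val (g s)) (psi (row_matrix s (c s))).
  by rewrite eg; exact: eqg_refl.
have gbe := eqg_psiM gg be; move=> /(contra_not (eqg_PsiP gbe).2)/cfm_neq0[x [t]].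
pose m : cfm (Xup i) K := row_matrix s (c s) * e; rewrite -/m => mxt.
have m0 u v : u != s -> m u v = 0.
  move=> us; apply/eqP; apply: contrapT => /negP/cfm_mul_neq0[w []].
  by rewrite row_matrixE (negPf us) eqxx.
have {x mxt} mst : m s t != 0.
  by have [xs|/m0 xs] := eqVneq x s; [rewrite -xs|rewrite xs eqxx in mxt].
(* As [m] lives on row [s] only, multiplying it by this row [t] rescales the entry [m s t] to 1 and
   restores row [s] of [c]. *)
have [f _ fe] := row_matrix_inH t (fun y => (m s t)^-1 * c s y) mi.
exists f; apply: eqg_sub_Psi gg.
have -> : row_matrix s (c s) = m * row_matrix t (fun y => (m s t)^-1 * c s y).
  apply: cfmP => u v; rewrite mul_row_matrix row_matrixE.
  have [->|/m0 ->] := eqVneq u s; last by rewrite mul0r.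
  by rewrite mulVKf.
by apply: eqg_psiM => //; rewrite fe; exact: eqg_refl.
Qed.

(** Summands of [q] above [i] keep the product in H(P,i), those strictly below move it down, and
    incomparable ones give 0. *)
Lemma Hi_mulr i (p q : Q) : Hi i p -> HJ setT q ->
  exists2 h, Hi i h & HJ [set j | (j < i)%O] (p * q - h).
Proof.
move=> pi [s [hs ->]]; elim: s hs => [|b s IH] hs.
  by exists 0; [exact: Hi0|rewrite big_nil mulr0 subrr; exact: HJ0].
have [|h hi lo] := IH; first by move=> b' bs; apply: hs; rewrite inE bs orbT.
have [|j _ bj] := hs b; first by rewrite inE eqxx.
rewrite big_cons mulrDr; have [ij|ij] := boolP (i <= j)%O.
  exists (p * b + h); first by apply: HiD hi; have [] := Hi_mul_le ij pi bj.
  by rewrite opprD addrACA subrr add0r.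
exists h => //; rewrite -addrA; apply: HJD lo.
have [ji|ji] := boolP (j <= i)%O.
  have [_ h'] := Hi_mul_le ji bj pi; apply: Hi_HJ h' => /=.
  by rewrite lt_neqAle ji andbT; apply: contra ij => /eqP ->.
have [c ->] := Hi_psi pi; have [e ->] := Hi_psi bj.
by rewrite psi_incomparable //; exact: HJ0.
Qed.

Lemma HJ_lift (J : set P) b : HJ J (frakB_val b) -> exists2 s : seq B,
  (forall u, u \in s -> exists2 j, J j & inH j u) & b = \sum_(u <- s) u.
Proof.
move=> [s [hs eb]].
have /choice[g gP] (q : Q) : exists u : B, HJ setT q -> frakB_val u = q.
  have [h|nh] := pselect (HJ (P := P) setT q); last by exists 0.
  by exists (FrakB Pcof h).
have sg q : q \in s -> frakB_val (g q) = q.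
  by move=> /hs[j _ qj]; apply: gP; exact: Hi_HJ qj.
exists [seq g q | q <- s].
  by move=> _ /mapP[q qs ->]; have [j Jj qj] := hs _ qs; exists j => //; rewrite /inH /= sg.
apply: frakB_val_inj; rewrite eb {eb hs} big_map.
elim: s sg => [|q s IH] sg; first by rewrite !big_nil.
rewrite !big_cons frakB_valD sg ?mem_head // -IH // => q' qs.
by apply: sg; rewrite inE qs orbT.
Qed.

Lemma HJ_sub_ideal (J : set P) (S : set B) b : right_ideal S ->
  (forall j, J j -> inH j `<=` S) -> HJ J (frakB_val b) -> S b.
Proof.
move=> hS JS /HJ_lift[s hs ->]; apply: right_ideal_sum => // u /hs[j Jj uj].
exact: JS uj.
Qed.

(** The error terms of [Hi_mulr] have indices strictly below [i], so they lie both in [S] and in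
    [Psi i]. *)
Lemma inH_mulr i a b (S : set B) : right_ideal S -> (forall j, (j < i)%O -> inH j `<=` S) ->
  inH i a -> exists h, [/\ inH i h, S (a * b - h) & Psi i (a * b - h)].
Proof.
move=> hS lowS Ha; have [q Hq lo] := Hi_mulr Ha (frakBP b).
pose h : B := FrakB Pcof (Hi_HJ (J := setT) I Hq).
have {lo}lo : HJ [set j | (j < i)%O] (frakB_val (a * b - h)) by [].
exists h; split=> //; first exact: HJ_sub_ideal lo.
by apply: HJ_sub lo => j ji; apply/negP => /le_lt_trans/(_ ji); rewrite ltxx.
Qed.

Lemma inH_incomparable i j a b : ~~ (i <= j)%O -> ~~ (j <= i)%O ->
  inH i a -> inH j b -> a * b = 0.
Proof.
move=> ij ji /Hi_psi[c ac] /Hi_psi[e be].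
by apply: frakB_val_inj; rewrite frakB_valM ac be psi_incomparable.
Qed.

(** The image of a diagonal matrix unit is the diagonal idempotent on the indices that restrict to
    the same element of X(i<=) as [x]. *)
Lemma psi_diag i (x : X) (xi : idx_chain x i) (y z : X) :
  psi (row_matrix (restr xi) (fun t => (restr xi == t)%:R : K)) y z =
  ((y == z) && `[< exists yi : idx_chain y i, restr yi = restr xi >])%:R.
Proof.
have [yz|nyz] := pselect (agree i y z); last first.
  rewrite -[LHS]/(psi_fun _ _ _) psi_fun_nagree //; case: eqP => //= eyz.
  case: asboolP => // -[yi _]; case: nyz.
  by rewrite -eyz; exact: agree_refl.
rewrite (psi_agree _ (agree_l yz) (agree_r yz)) // row_matrixE.
case: eqP => [ey|ny]; last first.
  by case: asboolP => [[yi ey]|_]; rewrite ?andbF //; case: ny; rewrite -ey; exact: restr_irr.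
rewrite asboolT ?andbT; last by exists (agree_l yz).
congr (nat_of_bool _)%:R; apply/eqP/eqP => [ez|eyz].
  rewrite -[LHS](glue_restr (agree_l yz) (agree_l yz)); last exact: agree_refl (agree_l yz).
  by rewrite ey ez (glue_restr (agree_l yz) (agree_r yz)) //; exact: agree_sym.
by rewrite -ey; move: (agree_l yz) (agree_r yz); rewrite eyz => h h'; exact: restr_irr.
Qed.

(** All idempotents come from one index [x] whose chain contains every [c n]: [e n] is the diagonal
    idempotent on the indices equal to [x] above [c n]. These sets shrink as [c n] descends, which
    gives the product relation. *)
Lemma descending_idempotents (c : nat -> P) :
    (forall n, (c n.+1 < c n)%O) -> (forall n, ~ maximal_element (c n)) ->
  exists e : nat -> B,
    [/\ forall n, inH (c n) (e n), forall n, ~ Psi (c n) (e n),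
        forall n, e n * e n = e n & forall n, e n.+1 * e n = e n.+1].
Proof.
move=> cdec cmax.
have cmono n m : (c (n + m)%N <= c n)%O.
  elim: m => [|m IH]; first by rewrite addn0.
  by rewrite addnS; apply: le_trans IH; exact: ltW.
have [|A hA cA] := @maximal_chain_ext _ P (range c).
  move=> _ _ [n _ <-] [m _ <-]; case/orP: (leq_total n m) => /subnKC <-.
    by right; exact: cmono.
  by left; exact: cmono.
have [x xA _] := ex_generic N_inf [::] hA.
have xc n : idx_chain x (c n) by rewrite xA; apply: cA; exists n.
pose D n y := `[< exists yi : idx_chain y (c n), restr yi = restr (xc n) >].
have /choice[e eP] : forall n, exists b, [/\ inH (c n) b, ~ Psi (c n) b &
    forall y z, frakB_val b y z = ((y == z) && D n y)%:R].
  move=> n; have [b Hb eb] := row_matrix_inH (restr (xc n))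
    (fun t => (restr (xc n) == t)%:R) (cmax n).
  exists b; split=> //; last by move=> y z; rewrite eb psi_diag.
  move=> /(inH_Psi_eq0 Hb) b0; have := psi_diag (xc n) x x.
  rewrite -eb b0 eqxx asboolT; last by exists (xc n).
  by move/esym/eqP; rewrite -[cfm_fun _ x x]/(0 : K) oner_eq0.
have mulE n m y z : cfm_fun (frakB_val (e n * e m)) y z = ((y == z) && (D n y && D m y))%:R.
  have [_ _ en] := eP n; have [_ _ em] := eP m.
  have h u : u \notin [fset z]%fset -> frakB_val (e m) u z = 0.
    by rewrite inE em => /negPf ->.
  rewrite [LHS](cfm_mulE_fset _ _ h) big_seq_fset1 en em eqxx /=.
  by have [->|] := eqVneq y z; rewrite ?mul0r //=; case: (D n z); rewrite /= ?mul1r ?mul0r.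
exists e; split=> n; try by have [] := eP n.
  by apply: frakB_val_inj; apply: cfmP => y z; have [_ _ ->] := eP n; rewrite mulE andbb.
apply: frakB_val_inj; apply: cfmP => y z; have [_ _ ->] := eP n.+1.
rewrite mulE; congr (nat_of_bool (_ && _))%:R; rewrite andb_idr //.
move=> /asboolP[yi yx]; apply/asboolP.
have le_c : (c n.+1 <= c n)%O by exact: ltW.
have chainE k : (c n.+1 <= k)%O -> idx_chain y k = idx_chain x k.
  move=> ck; have := congr1 (fun s : Xup (c n.+1) => idx_chain s (exist _ k ck)) yx.
  by rewrite /restr /idx_chain.
have yi' : idx_chain y (c n) by rewrite chainE.
exists yi'; apply: index_eq => [k|].
  have ck := le_trans le_c (valP k).
  exact: (congr1 (fun s : Xup (c n.+1) => idx_map s (exist _ (val k) ck)) yx).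
by apply/funext => k; apply: chainE; exact: le_trans (valP k).
Qed.
End FrakBIdeals.

(** * Descending sequences and minimal elements *)

Section ArtinianPosets.
Local Open Scope classical_set_scope.
Variables (d : Order.disp_t) (P : porderType d).

Lemma strictly_decreasing_seq (S : set P) :
    S !=set0 -> (forall i, S i -> exists2 j, S j & (j < i)%O) ->
  exists2 c : nat -> P, forall n, S (c n) & forall n, (c n.+1 < c n)%O.
Proof.
move=> [i0 Si0] h.
have /choice[g gP] : forall i, exists j, S i -> S j /\ (j < i)%O.
  move=> i; have [Si|nSi] := pselect (S i); last by exists i.
  by have [j Sj ji] := h i Si; exists j.
pose c n := iter n g i0.
have Sc n : S (c n) by elim: n => [//|n /gP[]].
by exists c => // n; have [] := gP _ (Sc n).
Qed.

Lemma artinian_min (S : set P) : artinian_poset P -> S !=set0 ->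
  exists2 i, S i & forall j, (j < i)%O -> ~ S j.
Proof.
move=> artP S0; apply: contrapT => nmin.
have [i Si|c _ cdec] := strictly_decreasing_seq S0.
  apply: contrapT => nj; apply: nmin; exists i => // j ji Sj.
  by apply: nj; exists j.
have [n cn] := artP c (fun n => ltW (cdec n)).
by have := cdec n; rewrite (cn n.+1) ?leqnSn // ltxx.
Qed.

Lemma not_artinian_chain : ~ artinian_poset P ->
  exists c : nat -> P, forall n, (c n.+1 < c n)%O.
Proof.
move=> /existsNP[f /not_implyP[fdec /forallNP fn]].
have fmono n m : (n <= m)%N -> (f m <= f n)%O.
  move=> /subnKC <-; elim: (m - n)%N => [|k IH]; first by rewrite addn0.
  by rewrite addnS; apply: le_trans IH.
have [||c _ cdec] := @strictly_decreasing_seq (range f); last by exists c.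
  by exists (f 0%N), 0%N.
move=> _ [n _ <-]; have /existsNP[m /not_implyP[nm fmn]] := fn n.
exists (f m); first by exists m.
by rewrite lt_neqAle fmono // andbT; apply/eqP.
Qed.
End ArtinianPosets.

(** * Primitive ideals, the semiartinian property and the equivalences *)

Section MainProof.
Local Open Scope classical_set_scope.
Local Open Scope ring_scope.
Variables (dN : Order.disp_t) (N : bOrderType dN) (N_inf : infinite_set [set: N]).
Variables (K : fieldType) (d : Order.disp_t) (P : porderType d) (Pcof : finite_cofinal P).
Local Notation B := (frakB N K Pcof).
Local Notation Psi := (Psi N K Pcof).
Local Notation inH := (@inH _ N K _ P Pcof).
Implicit Types (i j k : P) (a b f r : B).

Lemma Psi_order i j : (i <= j)%O <-> Psi i `<=` Psi j.
Proof.
split=> [|h]; first exact: Psi_mono.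
apply: contrapT => /negP ij; have [u uj nu] := inH_neq0 N_inf K Pcof j.
by apply/nu/h/(inH_Psi ij).
Qed.

(** With [y] atomic outside [Psi i], the right ideal [m] annihilates the class of [y], so the
    quotient by [m] is the simple module generated by that class. Primeness of [Psi i] shows that
    nothing outside [Psi i] annihilates it. *)
Lemma Psi_primitive i : right_primitive (Psi i).
Proof.
have [h Hh nh] := inH_neq0 N_inf K Pcof i; have [s hs eh] := inH_atomic N_inf Hh.
have [y [_ yat] ny] : exists2 y, atomic i y & ~ Psi i y.
  apply: contrapT => ns; apply: nh; rewrite eh.
  apply: right_ideal_sum => [|y ys]; first exact: Psi_right_ideal.
  by apply: contrapT => ny; apply: ns; exists y => //; exact: hs.
pose m : set B := [set r | Psi i (y * r)].
have maxm : maximal_right_ideal m.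
  split=> [||b /yat[f yf]].
  - apply: right_idealP => [|u v yu yv|u a yu]; rewrite /m /=.
    + by rewrite mulr0; exact: Psi0.
    + by rewrite mulrDr; exact: PsiD.
    + by rewrite mulrA; exact: PsiMr.
  - by rewrite /m /= mulr1.
  - by exists f; rewrite /m /= mulrBr mulr1 mulrA.
suff -> : Psi i = [set a | forall r, m (r * a)] by exact: maximal_right_ideal_primitive.
apply/seteqP; split=> a; first by move=> ia r; rewrite /m /=; do 2!apply: PsiMl => //.
move=> /= ha; apply: contrapT => na.
have [r nr] := Psi_prime N_inf ny na.
by apply: nr; rewrite -mulrA; exact: ha.
Qed.

Lemma frakB_ideal_full (S : set B) : right_ideal S -> (forall j, inH j `<=` S) -> S 1.
Proof. by move=> hS h; apply: (@HJ_sub_ideal _ _ _ _ _ _ setT) => //; exact: frakBP. Qed.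

Lemma artinian_primitive (I : set B) : artinian_poset P -> right_primitive I ->
  exists i, Psi i = I.
Proof.
move=> artP /right_primitive_ideal[hI IMl I1 Iprime].
have [|i nHi imin] := @artinian_min _ P [set i | ~ inH i `<=` I] artP.
  apply: contrapT => h; apply: I1; apply: frakB_ideal_full => // j.
  by apply: contrapT => nj; apply: h; exists j.
have low j : (j < i)%O -> inH j `<=` I by move=> /imin/contrapT.
have PsiI : Psi i `<=` I.
  move=> b; apply: HJ_sub_ideal => // j /= ij.
  have [ji|ji] := boolP (j <= i)%O.
    by apply: low; rewrite lt_neqAle ji andbT; apply: contra ij => /eqP ->.
  (* For [j] incomparable to [i]: modulo [I], [a * r] is in H(P,i) and hence kills [u], so primeness
     of [I] puts [u] in [I]. *)
  move=> u uj; have /existsNP[a /not_implyP[ai na]] := nHi.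
  apply: contrapT => nu; have [r] := Iprime _ _ na nu; apply.
  have [h [hi Ih _]] := inH_mulr r hI low ai.
  rewrite -(subrK h (a * r)) mulrDl (inH_incomparable ij ji hi uj) addr0.
  exact: right_idealM.
(* An element [b] of [I] outside [Psi i] would put every atomic [y] in [I]: modulo [Psi i], [y] is a
   multiple of some [y * (r * b)]. *)
exists i; apply/seteqP; split=> // b Ib; apply: contrapT => nb; apply: nHi => a ai.
have [s hs ->] := inH_atomic N_inf ai; apply: right_ideal_sum => // y /hs[_ yat].
have [/PsiI //|ny] := pselect (Psi i y).
have [r nr] := Psi_prime N_inf ny nb; rewrite -mulrA in nr.
have [f /PsiI If] := yat _ nr; rewrite -[y](subKr (y * (r * b) * f)).
by apply: right_idealB => //; apply: right_idealM => //; do 2!apply: (IMl).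
Qed.

Section DescendingChain.
Variables (c : nat -> P) (cdec : forall n, (c n.+1 < c n)%O).

Lemma descending_nle n : ~~ (c n <= c n.+1)%O.
Proof. by apply/negP => /le_lt_trans/(_ (cdec n)); rewrite ltxx. Qed.

Definition chain_ideal : set B := [set b | forall n, Psi (c n) b].

Lemma chain_ideal_right : right_ideal chain_ideal.
Proof.
apply: right_idealP => [n|x y Tx Ty n|x a Tx n]; first exact: Psi0.
  exact: PsiD.
exact: PsiMr.
Qed.

Lemma chain_ideal1 : ~ chain_ideal 1.
Proof.
move=> /(_ 0%N); have [u _ nu] := inH_neq0 N_inf K Pcof (c 0%N).
by move=> h; apply: nu; rewrite -[u]mul1r; exact: PsiMr.
Qed.

(** An atomic [y] outside [Psi (c n)] has a multiple through H(P,c (n+1)) that is outside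
    [chain_ideal] but inside [Psi (c n)]. Recovering [y] from it modulo [chain_ideal] puts [y] in
    [Psi (c n)]. *)
Lemma chain_not_semiartinian : ~ semiartinian B.
Proof.
move=> /semiartinianE/(_ chain_ideal_right chain_ideal1)[y yat /existsNP[n ny]].
have [h hn nh] := inH_neq0 N_inf K Pcof (c n.+1).
have ny' : ~ Psi (c n.+1) y by move=> /(Psi_mono (ltW (cdec n))).
have [r nr] := Psi_prime N_inf ny' nh.
have hPsi : Psi (c n) h by exact: (inH_Psi (descending_nle n)) hn.
have [yrh|[r' yrhr']] := yat (r * h).
  by apply: nr; rewrite -mulrA; exact: yrh.
apply: ny; rewrite -[y](subKr (y * (r * h) * r')).
apply: (right_idealB (Psi_right_ideal N_inf K Pcof (c n))); last exact: yrhr'.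
by apply: PsiMr => //; do 2!apply: PsiMl => //.
Qed.

Lemma chain_extra_primitive : (forall n, ~ maximal_element (c n)) ->
  exists2 I : set B, right_primitive I & forall i, Psi i <> I.
Proof.
move=> cmax; have [e [eH ne ee ee']] := descending_idempotents N_inf K Pcof cdec cmax.
have eeM n m : (n <= m)%N -> e m * e n = e m.
  move=> /subnKC <-; elim: (m - n)%N => [|k IH]; first by rewrite addn0.
  by rewrite addnS -ee' -mulrA IH.
pose m0 : set B := [set r | exists n, chain_ideal (e n * r)].
have hm0 : right_ideal m0.
  apply: right_idealP => [|x y [n hn] [m hm]|x a [n hn]].
  - by exists 0%N; rewrite mulr0; exact: right_ideal0 chain_ideal_right.
  (* The idempotent of larger index absorbs the other on its right, so it sends both summands into
     [chain_ideal]. *)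
  - exists (maxn n m); rewrite mulrDr; apply: (right_idealD chain_ideal_right) => k.
      by rewrite -(eeM n) ?leq_maxl // -mulrA; apply: PsiMl.
    by rewrite -(eeM m) ?leq_maxr // -mulrA; apply: PsiMl.
  - by exists n; rewrite mulrA; exact: (right_idealM _ chain_ideal_right).
have m01 : ~ m0 1 by move=> [n /(_ n)]; rewrite mulr1; exact: ne.
have [m maxm m0m] := ex_maximal_right_ideal hm0 m01.
have [hm m1 _] := maxm.
exists [set a | forall r, m (r * a)]; first exact: maximal_right_ideal_primitive.
move=> i ei.
(* The element [1 - e n] is in [m0], being killed by [e n] on the left, so [m] cannot also contain
   [e n]. *)
have me n : ~ m (e n).
  move=> men; apply: m1; rewrite -[1](subrK (e n)); apply: right_idealD => //.
  apply: m0m; exists n; rewrite mulrBr mulr1 ee subrr.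
  exact: right_ideal0 chain_ideal_right.
(* If [c n <= i], then [Psi i] contains [e n.+1], which [m] does not. Otherwise H(P,i) lies in
   [chain_ideal] and so annihilates the simple module, yet [Psi i] does not contain it. *)
have [[n ni]|nn] := pselect (exists n, (c n <= i)%O).
  apply: (me n.+1); have : Psi i (e n.+1).
    apply: inH_Psi (eH n.+1); apply/negP => /(le_trans ni).
    exact/negP/descending_nle.
  by rewrite ei => /(_ 1); rewrite mul1r.
have [h hi nh] := inH_neq0 N_inf K Pcof i; apply: nh; rewrite ei => r.
apply: m0m; exists 0%N => n; do 2!apply: PsiMl => //.
by apply: inH_Psi hi; apply/negP => ni; apply: nn; exists n.
Qed.
End DescendingChain.

Lemma artinian_semiartinian : artinian_poset P -> semiartinian B.
Proof.
move=> artP; apply: semiartinianI => S hS S1.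
have [|i nHi imin] := @artinian_min _ P [set i | ~ inH i `<=` S] artP.
  apply: contrapT => h; apply: S1; apply: frakB_ideal_full => // j.
  by apply: contrapT => nj; apply: h; exists j.
have low j : (j < i)%O -> inH j `<=` S by move=> /imin/contrapT.
have [y [yi yat] ny] : exists2 y, atomic i y & ~ S y.
  apply: contrapT => ns; apply: nHi => a ai; have [s hs ->] := inH_atomic N_inf ai.
  apply: right_ideal_sum => // y ys.
  by apply: contrapT => ny; apply: ns; exists y => //; exact: hs.
(* The difference of [y * r] and [h] is in both [S] and [Psi i], so relations modulo [Psi i] become
   relations in H(P,i) and then relations modulo [S]. *)
exists y => // r; have [h [hi Sh Psih]] := inH_mulr r hS low yi.
have [Psiyr|/yat[f Psif]] := pselect (Psi i (y * r)).
  left; have h0 : h = 0.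
    apply: (inH_Psi_eq0 N_inf hi); rewrite -[h](subKr (y * r)).
    exact: (right_idealB (Psi_right_ideal N_inf K Pcof i)).
  by rewrite h0 subr0 in Sh.
right; exists f; have [g [gi Sg Psig]] := inH_mulr f hS low hi.
(* [y r f - y] is [g - y] up to terms of [S] and [Psi i], and [inH i] meets [Psi i] in 0. *)
have gy : inH i (g - y).
  by apply: HiD gi _; rewrite -[X in Hi _ X]scaleN1r; exact: HiZ.
have eg : y * r * f - y = (y * r - h) * f + (h * f - g) + (g - y).
  by rewrite mulrBl !addrA !subrK.
have g0 : g - y = 0.
  apply: (inH_Psi_eq0 N_inf gy).
  have -> : g - y = (y * r * f - y) - ((y * r - h) * f + (h * f - g)).
    by rewrite eg [_ + (g - y)]addrC addrK.
  apply: (right_idealB (Psi_right_ideal N_inf K Pcof i)) => //.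
  by apply: PsiD => //; exact: PsiMr.
by rewrite eg g0 addr0; apply: right_idealD => //; exact: right_idealM.
Qed.

Lemma Psi_iso_iff_artinian : order_isomorphism (@Prim B) Psi <-> artinian_poset P.
Proof.
split=> [[[_ _ Psisurj] _]|artP].
  apply: contrapT => /not_artinian_chain[c cdec].
  (* The term [c 0] may be maximal, so the sequence is shifted by one. *)
  have cmax n : ~ maximal_element (c n.+1).
    by move=> /(_ _ (ltW (cdec n))) ec; have := cdec n; rewrite ec ltxx.
  have [I primI nI] := chain_extra_primitive (fun n => cdec n.+1) cmax.
  by have [i _ /nI] := Psisurj I primI.
split; last exact: Psi_order.
split=> [i _|i j _ _ ij|I /(artinian_primitive artP)[i]]; first exact: Psi_primitive.
  by apply: le_anti; apply/andP; split; apply/Psi_order; rewrite ij.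
by exists i.
Qed.

Lemma semiartinian_iff_artinian : artinian_poset P <-> semiartinian B.
Proof.
split=> [|semiB]; first exact: artinian_semiartinian.
by apply: contrapT => /not_artinian_chain[c /chain_not_semiartinian].
Qed.
End MainProof.

Theorem proposition6p7
    (dN : Order.disp_t) (aleph : bOrderType dN) (aleph_card : infinite_cardinal aleph)
    (K : fieldType)
    (d : Order.disp_t) (I : porderType d) (I_aleph : aleph_poset aleph I)
    (I_cof : finite_cofinal I) :
  (order_isomorphism (@Prim (frakB aleph K I_cof)) (Psi aleph K I_cof)
     <-> artinian_poset I) /\
  (artinian_poset I <-> semiartinian (frakB aleph K I_cof)).
Proof.
have [_ _ aleph_inf] := aleph_card.
by split; [exact: Psi_iso_iff_artinian|exact: semiartinian_iff_artinian].
Qed.
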